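(* Let $F$ be a totally real number field of degree $n$ over $\mathbb{Q}$, let $\nu\in\mathcal{O}_F^*$ be totally positive and let $\mathcal{I}\subseteq\mathcal{O}_F$ be a non-zero integral ideal, both fixed. Then there exists a positive constant $k_0$ such that for all integers $k>k_0$ (with $k>2$), the Hilbert Poincaré series $\mathcal{P}_{\vec{k},\nu,\mathcal{I}}$ of parallel weight $\vec{k}=(k,\dots,k)$ is not identically zero.
   Context: $F$ has real embeddings $\sigma_1,\dots,\sigma_n$; $\alpha_j=\sigma_j(\alpha)$; $\alpha\gg0$ means all $\alpha_j>0$. $\mathcal{O}_F^*=\{\mu\in F:\mathrm{tr}(\mu\mathcal{O}_F)\subseteq\mathbb{Z}\}$. $SL_2(\mathcal{O}_F)$ acts on $\mathbb{H}^n$ componentwise via the embeddings by Möbius transformations. For $M=\begin{pmatrix}*&*\\ \gamma&\delta\end{pmatrix}\in SL_2(\mathcal{O}_F)$, $z\in\mathbb{H}^n$, $k\in\mathbb{Z}^n$: $\mu(M,z)^{k}=\prod_{j}(\gamma_jz_j+\delta_j)^{k_j}$; $\mathrm{tr}(mz)=\sum_j m_jz_j$. $\Gamma_0(\mathcal{I})=\{\begin{pmatrix}\alpha&\beta\\ \gamma&\delta\end{pmatrix}\in SL_2(\mathcal{O}_F):\gamma\in\mathcal{I}\}$, $\Gamma_\infty=\{\begin{pmatrix}1&\mu\\0&1\end{pmatrix}:\mu\in\mathcal{O}_F\}$. For $k$ with all $k_j>2$ and totally positive $\nu\in\mathcal{O}_F^*$, $\mathcal{P}_{k,\nu,\mathcal{I}}(z)=\sum_{M\in\Gamma_\infty\backslash\Gamma_0(\mathcal{I})}\mu(M,z)^{-k}e^{2\pi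 i\,\mathrm{tr}(\nu(Mz))}$. $\vec{k}=(k,\dots,k)$.
   Formalization: The theorem is stated for weights k with nk even; when n and k are both odd, the terms of the cosets of M and −M cancel and the series is identically zero (e.g. F = Q, k odd), so the claim fails there. *)

(* Defs.v *)
From HB Require Export structures.
From mathcomp Require Export all_boot all_order all_algebra all_field.
From mathcomp Require Export complex.
From mathcomp Require Export all_classical all_reals all_analysis.
From mathcomp Require Import ring.

Set Implicit Arguments.
Unset Strict Implicit.
Unset Printing Implicit Defensive.

Import Order.TTheory GRing.Theory Num.Theory.
Local Open Scope classical_set_scope.
Local Open Scope ring_scope.

Section Complex.
Variable R : realType.

Definition expC (z : R[i]) : R[i] :=
  (expR (complex.Re z))%:C%C *
  (cos (complex.Im z) +i* sin (complex.Im z))%C.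

(* Unconditional summation: convergence along the directed set of finite
   subsets of D; for complex families this is absolute summability. *)
Definition has_sum (T : choiceType) (D : set T) (f : T -> R[i]) (s : R[i]) :=
  forall e : R, 0 < e ->
  exists2 A0, fsets D A0 &
    forall A, fsets D A -> A0 `<=` A ->
      `|\sum_(i \in A) f i - s| < e%:C%C.

(* 0 when the family is not summable. *)
Definition csum (T : choiceType) (D : set T) (f : T -> R[i]) : R[i] :=
  xget 0 [set s | has_sum D f s].

End Complex.

Section NumberField.
Variable F : fieldExtType rat.

Definition ring_of_integers : set F :=
  [set x | integralOver (intr : int -> F) x].

Definition integral_ideal (I : set F) :=
  [/\ I `<=` ring_of_integers, I 0,
      forall x y, I x -> I y -> I (x + y) &
      forall a x, ring_of_integers a -> I x -> I (a * x)].

Definition nonzero_ideal (I : set F) := exists2 x, I x & x != 0.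

Definition SL2_OF : set 'M[F]_2 :=
  [set M : 'M[F]_2 | (forall i j, ring_of_integers (M i j)) /\ \det M = 1].

Definition Gamma0 (I : set F) : set 'M[F]_2 :=
  [set M : 'M[F]_2 | SL2_OF M /\ I (M 1 0)].

Definition Gamma_inf : set 'M[F]_2 :=
  [set T : 'M[F]_2 |
    [/\ T 0 0 = 1, ring_of_integers (T 0 1), T 1 0 = 0 & T 1 1 = 1]].

Definition Gamma_inf_coset (M : 'M[F]_2) : set 'M[F]_2 :=
  [set T *m M | T in Gamma_inf].

(* Gamma_inf \ Gamma0 I, each class being a set of matrices. *)
Definition Gamma_inf_quot (I : set F) : set (set 'M[F]_2) :=
  Gamma_inf_coset @` Gamma0 I.

End NumberField.

Section Embeddings.
Variables (F : fieldExtType rat) (R : realType).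

Definition totally_real :=
  forall (tau : {rmorphism F -> R[i]}) (x : F), tau x \is Num.real.

Variables (n : nat) (sigma : 'I_n -> {rmorphism F -> R}).

Definition enumerates_real_embeddings :=
  forall tau : {rmorphism F -> R}, exists! j, tau =1 sigma j.

Definition totally_positive (a : F) := forall j, 0 < sigma j a.

Definition trF (a : F) : R := \sum_(j < n) sigma j a.

(* O_F^*, the inverse different. *)
Definition dual_of_integers : set F :=
  [set m | forall x, ring_of_integers x -> trF (m * x) \is a Num.int].

Definition upper_half_space : set ('I_n -> R[i]) :=
  [set z | forall j, 0 < complex.Im (z j)].

Definition cemb (j : 'I_n) (a : F) : R[i] := (sigma j a)%:C%C.

Definition moebius (M : 'M[F]_2) (z : 'I_n -> R[i]) : 'I_n -> R[i] :=
  fun j => (cemb j (M 0 0) * z j + cemb j (M 0 1)) /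
           (cemb j (M 1 0) * z j + cemb j (M 1 1)).

(* mu(M, z) ^ k *)
Definition mu_pow (M : 'M[F]_2) (z : 'I_n -> R[i]) (k : 'I_n -> int) : R[i] :=
  \prod_(j < n) (cemb j (M 1 0) * z j + cemb j (M 1 1)) ^ k j.

Definition tr_mul (a : F) (z : 'I_n -> R[i]) : R[i] :=
  \sum_(j < n) cemb j a * z j.

Definition poincare_term (k : 'I_n -> int) (nu : F) (z : 'I_n -> R[i])
    (M : 'M[F]_2) : R[i] :=
  mu_pow M z (fun j => - k j) *
  expC ((2 * pi)%:C%C * 'i%C * tr_mul nu (moebius M z)).

(* Each class contributes the term of a chosen representative; for nu in O_F^*
   the term does not depend on the choice. *)
Definition hilbert_poincare (k : 'I_n -> int) (nu : F) (I : set F)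
    (z : 'I_n -> R[i]) : R[i] :=
  csum (Gamma_inf_quot I) (fun C => poincare_term k nu z (xget 1%:M C)).

End Embeddings.

Unset Implicit Arguments.

Lemma has_sum_odd (R : realType) (T : choiceType) (D : set T) (f : T -> R[i]) s (i : T -> T) :
  involutive i -> (forall x, D x -> D (i x)) -> (forall x, D x -> f (i x) = - f x) ->
  has_sum D f s -> s = 0.
Proof.
move=> ii Di fi hs; apply/eqP; rewrite -normr_eq0; apply/negPn/negP => s0.
have ps : 0 < complex.Re `|s|.
  by move: s0; rewrite -normr_gt0 normr_id; case: s {hs} => a b; rewrite normc_def ltcE /= => /andP[].
have [A0 [fA0 A0D] hA] := hs _ ps.
have D2 : i @` A0 `<=` D by move=> _ [x /A0D Dx <-]; exact: Di.
have fA : finite_set (A0 `|` i @` A0) by rewrite finite_setU; split => //; exact: finite_image.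
have AD : (A0 `|` i @` A0) `<=` D by move=> x [/A0D|/D2].
have := hA (A0 `|` i @` A0) (conj fA AD) (@subsetUl _ _ _).
suff -> : \sum_(j \in A0 `|` i @` A0) f j = 0.
  rewrite sub0r normrN; case: s {hs hA ps s0} => a b; rewrite normc_def ltcE /=.
  by rewrite ltxx andbF.
set A := A0 `|` _ in fA AD *.
have bi : set_bij A A i.
  split.
  - move=> x [Ax|[y Ay <-]]; [right; by exists x|left; by rewrite ii].
  - by move=> x y _ _ /(congr1 i); rewrite !ii.
  - by move=> x [Ax|[y Ay <-]]; [exists (i x); [right; exists x|rewrite ii]|exists y => //; left].
have E : \sum_(j \in A) f j = - \sum_(j \in A) f j.
  rewrite [LHS](reindex_fsbig i A A) //.
  rewrite !fsbig_finite //= -sumrN big_seq_cond [RHS]big_seq_cond.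
  apply: eq_bigr => x; rewrite andbT in_fset_set // inE => Ax.
  by rewrite fi //; apply: AD.
apply/eqP; move/eqP: E; rewrite -addr_eq0 -mulr2n mulrn_eq0 /=. done.
Qed.

Section OddWeight.
Variable R : realType.

Lemma expCD (a b : R[i]) : expC (a + b) = expC a * expC b.
Proof.
case: a b => a b [c d]; rewrite /expC /= expRD cosD sinD; simpc.
by congr (_ +i* _)%C; ring.
Qed.

Lemma cos_sin_2pin (n : nat) : cos (2 * pi * n%:R : R) = 1 /\ sin (2 * pi * n%:R : R) = 0.
Proof.
elim: n => [|n [hc hs]]; first by rewrite mulr0 cos0 sin0.
have -> : 2 * pi * n.+1%:R = 2 * pi * n%:R + pi *+ 2 :> R.
  by rewrite -(addn1 n) natrD mulrDr mulr1 (mulr_natl pi 2).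
by rewrite cosD2pi sinD2pi.
Qed.

Lemma expC_2pi_int (x : R) : x \is a Num.int ->
  expC ((2 * pi)%:C%C * 'i%C * x%:C%C : R[i]) = 1.
Proof.
case/intrP => m ->.
have -> : ((2 * pi)%:C%C * 'i%C * (m%:~R : R)%:C%C : R[i]) = (0 +i* (2 * pi * m%:~R))%C.
  by simpc.
rewrite /expC /= expR0.
have [->->] : cos (2 * pi * m%:~R : R) = 1 /\ sin (2 * pi * m%:~R : R) = 0.
  case: m => n; first exact: cos_sin_2pin.
  by rewrite NegzE mulrNz mulrN cosN sinN; have [->->] := cos_sin_2pin n.+1; rewrite oppr0.
by simpc.
Qed.

Variables (F : fieldExtType rat) (n : nat) (sigma : 'I_n -> {rmorphism F -> R}).
Variables (nu : F) (I : set F).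
Hypothesis nuD : dual_of_integers sigma nu.
Variable z : 'I_n -> R[i].
Hypothesis zH : upper_half_space z.

Notation den M j := (cemb sigma j (M 1 0) * z j + cemb sigma j (M 1 1)).

Lemma det_mx2 (M : 'M[F]_2) : \det M = M 0 0 * M 1 1 - M 0 1 * M 1 0.
Proof.
have i0 : (ord0 : 'I_2) = 0 by apply/val_inj.
have i1 : lift (ord0 : 'I_2) (ord0 : 'I_1) = 1 by apply/val_inj.
have i2 : lift (1 : 'I_2) (ord0 : 'I_1) = 0 by apply/val_inj.
rewrite (expand_det_row _ 0) !big_ord_recl big_ord0 /cofactor !det_mx11 !mxE ?i1 ?i0 ?i2 /= ?i1.
by rewrite expr0 /= expr1 addr0 mul1r mulN1r mulrN.
Qed.

Lemma den_neq0 (M : 'M[F]_2) j : \det M = 1 -> den M j != 0.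
Proof.
move=> dM; apply/eqP; have := zH j; rewrite /cemb; case: (z j) => x y /= y0.
simpc => -[h1 /eqP]; rewrite mulf_eq0 (gt_eqF y0) orbF fmorph_eq0 => /eqP h2.
move: h1; rewrite h2 rmorph0 mul0r add0r => /eqP; rewrite fmorph_eq0 => /eqP h3.
by move: dM; rewrite det_mx2 h2 h3 !mulr0 subr0 => /esym/eqP; rewrite oner_eq0.
Qed.

Lemma mul_Gamma_inf (T M : 'M[F]_2) : Gamma_inf T ->
  [/\ (T *m M) 0 0 = M 0 0 + T 0 1 * M 1 0, (T *m M) 0 1 = M 0 1 + T 0 1 * M 1 1,
     (T *m M) 1 0 = M 1 0 & (T *m M) 1 1 = M 1 1].
Proof.
move=> [a b c d].
have i0 : (ord0 : 'I_2) = 0 by apply/val_inj.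
have i1 : lift (ord0 : 'I_2) (ord0 : 'I_1) = 1 by apply/val_inj.
by split; rewrite !mxE !big_ord_recl big_ord0 i1 i0 ?a ?c ?d ?mul1r ?mul0r ?addr0 ?add0r.
Qed.

Lemma poincare_termT k (T M : 'M[F]_2) : Gamma_inf T -> \det M = 1 ->
  poincare_term sigma k nu z (T *m M) = poincare_term sigma k nu z M.
Proof.
move=> GT dM; have [e1 e2 e3 e4] := mul_Gamma_inf T M GT.
rewrite /poincare_term; congr (_ * _).
  by rewrite /mu_pow; apply: eq_bigr => j _; rewrite e3 e4.
have -> : tr_mul sigma nu (moebius sigma (T *m M) z) =
   tr_mul sigma nu (moebius sigma M z) + (trF sigma (nu * T 0 1))%:C%C.
  rewrite /tr_mul /trF rmorph_sum -big_split /=; apply: eq_bigr => j _.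
  rewrite /moebius e1 e2 e3 e4 rmorphM rmorphM -!/(cemb sigma j _) -mulrDr.
  congr (_ * _); have := den_neq0 M j dM; rewrite /cemb !rmorphD !rmorphM /=.
  by move=> h; field.
rewrite mulrDr expCD expC_2pi_int ?mulr1 //.
by apply: nuD; case: GT.
Qed.

Lemma poincare_termN (k : int) (M : 'M[F]_2) : \det M = 1 -> ~~ (2 %| n%:Z * k)%Z ->
  poincare_term sigma (fun=> k) nu z (- M) = - poincare_term sigma (fun=> k) nu z M.
Proof.
move=> dM od; rewrite /poincare_term -mulNr; congr (_ * expC (_ * _)).
  rewrite /mu_pow.
  transitivity (\prod_(j < n) ((-1) ^ (- k) * den M j ^ (- k))).
    apply: eq_bigr => j _; rewrite !mxE.
    rewrite -(@exprzMl _ (-1) (den M j)) ?unitfE ?oppr_eq0 ?oner_eq0 ?den_neq0 //.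
    by rewrite /cemb !rmorphN; congr (_ ^ _); ring.
  rewrite big_split /= prodr_const card_ord -[RHS]mulN1r; congr (_ * _).
  have sgn (l : int) : (-1 : R[i]) ^ l = (-1) ^+ odd `|l|%N.
    case: l => m; first by rewrite -exprnP -[LHS]signr_odd.
    by rewrite NegzE abszN -exprnN -exprVn invrN1 -[LHS]signr_odd.
  rewrite sgn abszN -exprM mulnC -signr_odd oddM oddb -oddM.
  by move: od; rewrite dvdzE abszM /= dvdn2 negbK => ->.
rewrite /tr_mul; apply: eq_bigr => j _; congr (_ * _).
rewrite /moebius !mxE /cemb !rmorphN !mulNr -!opprD invrN mulrNN //.
Qed.

Lemma poincare_term_rep k C M : Gamma0 I M -> C = Gamma_inf_coset M ->
  poincare_term sigma k nu z (xget 1%:M C) = poincare_term sigma k nu z M.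
Proof.
move=> [[_ dM] _] ->; case: xgetP => [N _ [T GT <-]|/(_ M)]; first exact: poincare_termT.
case; exists 1%:M; rewrite ?mul1mx //; split; rewrite !mxE //=.
rewrite mulr0n; exact: mxpoly.integral0.
Qed.

(* -1 lies in Gamma0 I and mu(-1, z) ^ (k, ..., k) = (-1) ^ (n k), so for n k
   odd the terms of M and - M cancel. *)
Lemma hilbert_poincare_odd (k : int) : integral_ideal I -> ~~ (2 %| n%:Z * k)%Z ->
  hilbert_poincare sigma (fun=> k) nu I z = 0.
Proof.
move=> [_ _ _ idM] od; rewrite /hilbert_poincare /csum; case: xgetP => // s _ /= hs.
have intN (x : F) : ring_of_integers x -> ring_of_integers (- x).
  exact: mxpoly.integral_opp.
have GN M : Gamma0 I M -> Gamma0 I (- M).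
  move=> [[h1 dM] h2]; split; [split|].
  - by move=> i j; rewrite mxE; apply: intN.
  - by move: dM; rewrite !det_mx2 !mxE !mulrNN.
  - rewrite mxE -mulN1r; apply: idM => //; apply: intN; exact: mxpoly.integral1.
have cN M : [set - N | N in Gamma_inf_coset M] = Gamma_inf_coset (- M).
  apply/seteqP; split => N /=.
  - by move=> [_ [T GT <-] <-]; exists T => //; rewrite mulmxN.
  - by move=> [T GT <-]; exists (T *m M); [exists T|rewrite mulmxN].
apply: (has_sum_odd R _ _ _ s (fun C => [set - N | N in C]) _ _ _ hs).
- move=> C; apply/seteqP; split=> N /=.
    by move=> [_ [L CL <-] <-]; rewrite opprK.
  by move=> CN; exists (- N); rewrite ?opprK //; exists N.
- by move=> _ [M GM <-]; rewrite cN; exists (- M) => //; exact: GN.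
- move=> C [M GM e]; rewrite (poincare_term_rep _ _ M GM (esym e)) -e cN (poincare_term_rep _ _ (- M) (GN _ GM) erefl).
  by apply: poincare_termN => //; case: GM => -[].
Qed.
End OddWeight.

(* Main.v *)
Require Import Defs.
From mathcomp Require Import ring lra.
Import Order.TTheory GRing.Theory Num.Theory.
Import numFieldNormedType.Exports.
Local Open Scope classical_set_scope.
Local Open Scope ring_scope.

(** Evaluate the series at z_j = i t / nu_j with t large.  The cosets of
    Gamma_inf correspond to bottom rows (g, d), and with
    u_j = |g_j z_j + d_j| the absolute value of the term of (g, d) is
    prod_j u_j^-k exp(- 2 pi t / u_j^2).
    - The two rows (0, 1), (0, -1) each contribute exp(- 2 pi t n), with equal
      signs because n k is even.
    - For the other rows (0, d), d is a unit, the terms exp(- 2 pi t tr(d^-2))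
      do not depend on k, and tr(d^-2) > n by AM-GM, with a uniform gap since
      the sum converges at t = 1; so their sum is negligible for t large.
    - If g <> 0 then prod_j u_j >= t^n |N(g)| / N(nu) >= 2, so the sum over
      these rows is O(2^-k) once t is fixed.
    Absolute convergence at the weight 4 n: exp(- 2 pi t / u^2) tames the
    factors with u_j small, so the term is O((max_j u_j)^(-4n)), and
    x |-> (tr(nu x e_i))_i, for a Q-basis (e_i) of integers, embeds O_F in Z^n
    with coordinates O(max_j |x_j|). *)

(** * Unconditional sums *)

Section Modulus.
Variable R : realType.

(** The norm of [R[i]] takes values in [R[i]]; estimates with suprema and exponentials need the
    modulus as an element of [R]. *)
Definition cabs (z : R[i]) : R := complex.Re `|z|.

Lemma cabsE z : `|z| = (cabs z)%:C%C.
Proof. by rewrite /cabs normc_def. Qed.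

Lemma cabs_ge0 z : 0 <= cabs z.
Proof. by rewrite -ler0c -cabsE. Qed.

Lemma cabsM z w : cabs (z * w) = cabs z * cabs w.
Proof. by apply: complexI; rewrite rmorphM /= -!cabsE normrM. Qed.

Lemma cabsV z : cabs z^-1 = (cabs z)^-1.
Proof. by apply: complexI; rewrite fmorphV /= -!cabsE normfV. Qed.

Lemma cabs_prod (T : finType) (f : T -> R[i]) :
  cabs (\prod_i f i) = \prod_i cabs (f i).
Proof.
apply: complexI; rewrite rmorph_prod /= -cabsE normr_prod.
by apply: eq_bigr => i _; rewrite cabsE.
Qed.

Lemma cabsX z m : cabs (z ^+ m) = cabs z ^+ m.
Proof. by apply: complexI; rewrite rmorphXn /= -!cabsE normrX. Qed.

Lemma cabs_gt0 z : (0 < cabs z) = (z != 0).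
Proof. by rewrite -normr_gt0 cabsE -(ltcR 0). Qed.

Lemma ler_Re_cabs z : `|complex.Re z| <= cabs z.
Proof. by rewrite -lecR -cabsE normc_ge_Re. Qed.

Lemma ler_Im_cabs z : `|complex.Im z| <= cabs z.
Proof.
rewrite /cabs normc_def /= -sqrtr_sqr ler_wsqrtr //.
by rewrite lerDr sqr_ge0.
Qed.

Lemma cabs_sqr z : cabs z ^+ 2 = complex.Re z ^+ 2 + complex.Im z ^+ 2.
Proof. by apply: complexI; rewrite rmorphXn /= -cabsE -add_Re2_Im2. Qed.

Lemma cabs_expC z : cabs (expC z) = expR (complex.Re z).
Proof.
rewrite /expC cabsM.
have -> : cabs (expR (complex.Re z))%:C%C = expR (complex.Re z).
  by rewrite /cabs normc_def /= expr0n addr0 sqrtr_sqr ger0_norm ?expR_ge0.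
by rewrite /cabs normc_def /= cos2Dsin2 sqrtr1 mulr1.
Qed.

End Modulus.

Section Sums.
Variables (R : realType) (T : choiceType).

(** For nonnegative [f] this is summability with an explicit bound; duplicate-free lists make it
    easy to transport along injections. *)
Definition bounded_sums (D : set T) (f : T -> R) (B : R) :=
  forall s : seq T, uniq s -> (forall x, x \in s -> D x) -> \sum_(x <- s) f x <= B.

Lemma ler_sum_subset (S : eqType) (s t : seq S) (w : S -> R) :
  (forall x, 0 <= w x) -> uniq s -> uniq t -> {subset s <= t} ->
  \sum_(x <- s) w x <= \sum_(x <- t) w x.
Proof.
move=> w0 us ut st; rewrite (perm_big (seq.filter (mem s) t)) /=; last first.
  apply: uniq_perm; rewrite ?filter_uniq // => x; rewrite mem_filter /=.
  by case: (boolP (x \in s)) => // /st ->.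
by rewrite big_filter big_mkcond; apply: ler_sum => x _; case: ifP.
Qed.

Lemma has_sumD (D : set T) (f g : T -> R[i]) (s t c : R[i]) :
  has_sum D f s -> has_sum D g t ->
  has_sum D (fun x => f x + c * g x) (s + c * t).
Proof.
(* With tolerance [e / d] for both families the total error is at most
   [(1 + |c|) * e / d = e / 2]. *)
move=> hf hg e e0; pose d := 2 * (1 + cabs R c).
have d0 : 0 < d by rewrite mulr_gt0 // ltr_pwDl // cabs_ge0.
have ed0 : 0 < e / d by rewrite divr_gt0.
have [A0 [fA0 A0D] hA0] := hf _ ed0; have [A1 [fA1 A1D] hA1] := hg _ ed0.
exists (A0 `|` A1).
  by split; [rewrite /= finite_setU | move=> x [/A0D|/A1D]].
move=> A [fA AD] sA.
have h0 : `|\sum_(i \in A) f i - s| < (e / d)%:C%C.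
  by apply: hA0 => // x Ax; apply: sA; left.
have h1 : `|\sum_(i \in A) g i - t| < (e / d)%:C%C.
  by apply: hA1 => // x Ax; apply: sA; right.
move: h0 h1; rewrite !fsbig_finite // big_split /= -mulr_sumr.
move: (\sum_(_ <- _) f _) (\sum_(_ <- _) g _) => a b.
rewrite !cabsE !ltcR => h0 h1.
have -> : a + c * b - (s + c * t) = (a - s) + c * (b - t) by ring.
apply: (@le_lt_trans _ _ (cabs R (a - s) + cabs R c * cabs R (b - t))).
  by rewrite -lecR rmorphD rmorphM /= -!cabsE -normrM ler_normD.
apply: (@le_lt_trans _ _ (e / d + cabs R c * (e / d))).
  by apply: lerD; [exact: ltW | rewrite ler_wpM2l ?cabs_ge0 // ltW].
have -> : e / d + cabs R c * (e / d) = e / 2.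
  have c0 := cabs_ge0 R c; rewrite /d; field.
  by rewrite gt_eqF // ltr_pwDl.
by rewrite ltr_pdivrMr // ltr_pMr // ltr1n.
Qed.

(** The sum is the supremum of the finite partial sums, which increase with the index set. *)
Lemma has_sum_nonneg (D : set T) (g : T -> R) (B : R) :
  (forall x, 0 <= g x) -> bounded_sums D g B ->
  exists s, has_sum D (fun x => (g x)%:C%C) s.
Proof.
move=> g0 gB; pose E := [set r | exists2 A, fsets D A & r = \sum_(i \in A) g i].
have hsE : has_sup E.
  split; first by exists (\sum_(i \in set0) g i); exists set0 => //; split.
  exists B => r [A [fA AD] ->]; rewrite fsbig_finite //; apply: gB.
    exact: finmap.fset_uniq.
  by move=> x; rewrite in_fset_set // inE => /AD.
exists (sup E)%:C%C => e e0.
have [r [A0 [fA0 A0D] ->] hr] := sup_adherent e0 hsE.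
exists A0 => // A [fA AD] A0A.
have : \sum_(i \in A) g i <= sup E by apply: ub_le_sup; [case: hsE|exists A].
have : \sum_(i \in A0) g i <= \sum_(i \in A) g i.
  rewrite !fsbig_finite //; apply: ler_sum_subset => //; try exact: finmap.fset_uniq.
  by move=> x; rewrite !in_fset_set // !inE; apply: A0A.
rewrite [\sum_(i \in A) (g i)%:C%C]fsbig_finite // -rmorph_sum -rmorphB /=.
rewrite -fsbig_finite // normc_def ltcR /= expr0n addr0 sqrtr_sqr => h1 h2.
by rewrite ltr_norml; apply/andP; split; lra.
Qed.

(** Real and imaginary parts are treated separately, each written as a difference of nonnegative
    families, [u = (u + |u|) - |u|]. *)
Lemma has_sum_exists (D : set T) (f : T -> R[i]) (B : R) :
  bounded_sums D (fun x => cabs R (f x)) B -> exists s, has_sum D f s.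
Proof.
move=> fB.
have part (u : T -> R) : (forall x, `|u x| <= cabs R (f x)) ->
    exists s, has_sum D (fun x => (u x)%:C%C) s.
  move=> uf.
  have u1 s : uniq s -> (forall x, x \in s -> D x) -> \sum_(x <- s) `|u x| <= B.
    by move=> us sD; apply: le_trans (fB s us sD); apply: ler_sum => x _.
  have [s1 h1] : exists s, has_sum D (fun x => (u x + `|u x|)%:C%C) s.
    apply: (@has_sum_nonneg _ _ (B + B)).
      by move=> x; have := ler_norm (- u x); rewrite normrN; lra.
    move=> s us sD; rewrite big_split lerD ?u1 //.
    by apply: le_trans (u1 s us sD); apply: ler_sum => x _; apply: ler_norm.
  have [s2 h2] : exists s, has_sum D (fun x => (`|u x|)%:C%C) s.
    by apply: (@has_sum_nonneg _ _ B).
  exists (s1 + (-1) * s2).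
  have := has_sumD D _ _ _ _ (-1) h1 h2; congr has_sum.
  by apply/funext => x; rewrite mulN1r -rmorphB /= addrK.
have [s1 h1] := part (fun x => complex.Re (f x)) (fun x => ler_Re_cabs R (f x)).
have [s2 h2] := part (fun x => complex.Im (f x)) (fun x => ler_Im_cabs R (f x)).
exists (s1 + 'i%C * s2).
have := has_sumD D _ _ _ _ 'i%C h1 h2; congr has_sum.
by apply/funext => x; rewrite -complexE.
Qed.

(** A finite partial sum containing [x1] and [x2] has real part at least [2c - c = c], so it never
    comes within distance less than [c] of 0. *)
Lemma has_sum_neq0 (D : set T) (f : T -> R[i]) (c : R) (x1 x2 : T) :
  0 < c -> D x1 -> D x2 -> x1 != x2 -> f x1 = c%:C%C -> f x2 = c%:C%C ->
  bounded_sums [set x | [/\ D x, x != x1 & x != x2]] (fun x => cabs R (f x)) c ->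
  ~ has_sum D f 0.
Proof.
move=> c0 D1 D2 x12 f1 f2 fB /(_ c c0) [A0 [fA0 A0D] hA].
pose A := A0 `|` [set x1; x2].
have fA : finite_set A by rewrite /A !finite_setU.
have AD : A `<=` D by move=> x [/A0D//|[->|->]].
have := hA A (conj fA AD) (@subsetUl _ _ _); rewrite subr0 fsbig_finite //.
have us := finmap.fset_uniq (fset_set A).
have sA x : x \in finmap.enum_fset (fset_set A) -> A x by rewrite in_fset_set // inE.
have s1 : x1 \in finmap.enum_fset (fset_set A).
  by rewrite in_fset_set // inE; right; left.
have s2 : x2 \in finmap.enum_fset (fset_set A).
  by rewrite in_fset_set // inE; right; right.
move: us sA s1 s2; move: (finmap.enum_fset _) => s us sA s1 s2.
rewrite (bigD1_seq x1) //= -big_filter (bigD1_seq x2) ?filter_uniq //=; last first.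
  by rewrite mem_filter eq_sym x12.
rewrite -big_filter -filter_predI f1 f2 addrA -rmorphD cabsE ltcR => h.
set s' := seq.filter _ _ in h.
have le1 : cabs R (\sum_(x <- s') f x) <= c.
  apply: le_trans (fB s' _ _).
  - rewrite -lecR -cabsE rmorph_sum /=; apply: le_trans (ler_norm_sum _ _ _) _.
    by apply: ler_sum => x _; rewrite cabsE.
  - by rewrite filter_uniq.
  - by move=> x; rewrite mem_filter /= => /andP[/andP[? ?] /sA/AD].
have := ler_Re_cabs R (\sum_(x <- s') f x).
have := ler_Re_cabs R ((c + c)%:C%C + \sum_(x <- s') f x).
set w := \sum_(x <- s') f x in h le1 *; rewrite [complex.Re (_ + w)]raddfD /=.
rewrite !ler_norml => /andP[_ h1] /andP[h2 _]; lra.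
Qed.

(** An index with [x i < 1] contributes more than [exp(-1)], so there are finitely many of them; the
    gap is the minimum of 1 and these values. *)
Lemma bounded_sums_gap (D : set T) (x : T -> R) (B : R) :
  (forall i, D i -> 0 < x i) -> bounded_sums D (fun i => expR (- x i)) B ->
  exists2 g, 0 < g & forall i, D i -> g <= x i.
Proof.
move=> x0 xB; pose X := [set i | D i /\ x i < 1].
have fX : finite_set X.
  apply: contrapT => /(infinite_set_fset (Num.bound (B * expR 1))) [S SX leS].
  have := xB (finmap.enum_fset S) (finmap.fset_uniq S) (fun i iS => (SX i iS).1).
  apply/negP; rewrite -ltNge.
  apply: (@lt_le_trans _ _ (\sum_(i <- finmap.enum_fset S) expR (-1))).
    rewrite big_const_seq count_predT iter_addr_0 -mulr_natl expRN.
    rewrite ltr_pdivlMr ?expR_gt0 //; apply: lt_le_trans (archi_boundP _) _.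
      by rewrite mulr_ge0 ?expR_ge0 //; have := xB [::]; rewrite big_nil; apply.
    by rewrite ler_nat.
  rewrite big_seq [leRHS]big_seq; apply: ler_sum => i iS; rewrite ler_expR lerN2.
  by have [_ /ltW] := SX i iS.
exists (\big[Num.min/1]_(i <- finmap.enum_fset (fset_set X)) x i).
  rewrite big_seq; elim/big_rec: _ => // i y; rewrite in_fset_set // inE => -[Di _] y0.
  by rewrite lt_min y0 x0.
move=> i Di; have [xi|xi] := ltP (x i) 1.
  have : i \in finmap.enum_fset (fset_set X) by rewrite in_fset_set // inE.
  elim: (finmap.enum_fset _) => // j s IH; rewrite inE big_cons ge_min => /orP[/eqP <-|/IH ->].
    by rewrite lexx.
  by rewrite orbT.
apply: le_trans xi; elim/big_rec: _ => // j y _ y1.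
by rewrite ge_min y1 orbT.
Qed.

End Sums.

(** Comparison along an injection: it moves sums over cosets to bottom rows or units, and sums over
    bottom rows to integer vectors. *)
Lemma bounded_sums_map (R : realType) (S T : choiceType) (D : set S) (E : set T)
    (h : S -> T) (f : S -> R) (g : T -> R) (B : R) :
  bounded_sums R T E g B -> (forall x, D x -> E (h x)) ->
  (forall x y, D x -> D y -> h x = h y -> x = y) ->
  (forall x, D x -> f x <= g (h x)) -> bounded_sums R S D f B.
Proof.
move=> gB DE hI fg s us sD; apply: (@le_trans _ _ (\sum_(y <- map h s) g y)).
  by rewrite big_map big_seq [leRHS]big_seq; apply: ler_sum => x /sD/fg.
apply: gB; last by move=> _ /mapP[x /sD/DE Ex ->].
by rewrite map_inj_in_uniq // => x y /sD Dx /sD Dy; apply: hI.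
Qed.

Lemma bounded_sumsZ (R : realType) (T : choiceType) (D : set T) (f : T -> R) (a B : R) :
  0 <= a -> bounded_sums R T D f B ->
  bounded_sums R T D (fun x => a * f x) (a * B).
Proof. by move=> a0 fB s us sD; rewrite -mulr_sumr ler_wpM2l // fB. Qed.

(** * Inverse squares summed over integer vectors *)

Section IntegerVectors.
Variable R : realType.

Lemma sum_nat_inv_sqr (s : seq nat) : uniq s ->
  \sum_(m <- s) (1 + m%:R ^+ 2)^-1 <= 4 :> R.
Proof.
move=> us; pose N := (\max_(m <- s) m)%N.
apply: (@le_trans _ _ (\sum_(m <- iota 0 N.+1) (1 + m%:R ^+ 2)^-1)).
  apply: (ler_sum_subset _ _ _ _ _ _ us (iota_uniq _ _)) => [m|m ms].
    by rewrite invr_ge0 addr_ge0 ?sqr_ge0.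
  by move: ms => ms; rewrite mem_iota /= add0n ltnS (@leq_bigmax_seq _ _ xpredT id).
(* The sharper bound makes the induction telescope: [2/(N+1) - 2/(N+2)] dominates the new term
   [1/(1 + (N+1)^2)]. *)
apply: (@le_trans _ _ (4 - 2 / N.+1%:R)); last by rewrite gerBl divr_ge0.
elim: N => [|N IH]; first by rewrite big_seq1 expr0n addr0 invr1; lra.
rewrite -[N.+2]addn1 iotaD big_cat /= big_seq1 add0n addn1.
apply: le_trans (lerD IH (lexx _)) _; rewrite -[N.+2%:R]natr1 -[N.+1%:R]natr1.
have : (0 : R) <= N%:R by [].
move: (N%:R : R) => x x0; rewrite -subr_ge0.
have -> : 4 - 2 / (x + 1 + 1) - (4 - 2 / (x + 1) + (1 + (x + 1) ^+ 2)^-1) =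
  (x ^+ 2 + x + 2) / ((x + 1 + 1) * (x + 1) * (1 + (x + 1) ^+ 2)).
  field; rewrite !gt_eqF //; nra.
by rewrite divr_ge0 // ?mulr_ge0 //; nra.
Qed.

Lemma sum_int_inv_sqr (s : seq int) : uniq s ->
  \sum_(m <- s) (1 + m%:~R ^+ 2)^-1 <= 8 :> R.
Proof.
move=> us; rewrite (bigID (fun m : int => 0 <= m)) /= -[X in X + _]big_filter -[X in _ + X]big_filter.
have E (m : int) : (1 + m%:~R ^+ 2)^-1 = (1 + `|m|%N%:R ^+ 2)^-1 :> R.
  by rewrite natr_absz intr_norm real_normK // num_real.
under eq_bigr do rewrite E; under [X in _ + X]eq_bigr do rewrite E.
rewrite -!(big_map absz xpredT (fun m : nat => (1 + m%:R ^+ 2)^-1)).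
have -> : 8 = 4 + 4 :> R by lra.
apply: lerD; apply: sum_nat_inv_sqr; rewrite map_inj_in_uniq ?filter_uniq //.
  move=> x y; rewrite !mem_filter => /andP[x0 _] /andP[y0 _] /(congr1 Posz).
  by rewrite !gez0_abs.
move=> x y; rewrite !mem_filter -!ltNge => /andP[x0 _] /andP[y0 _] /(congr1 Posz).
by rewrite !ltz0_abs // => /oppr_inj.
Qed.

(** The vectors of [s] lie in a finite cube [vs^N], over which the sum of products is the [N]-th
    power of a one-variable sum. *)
Lemma sum_intvec_inv_sqr N (s : seq {ffun 'I_N -> int}) : uniq s ->
  \sum_(c <- s) \prod_i (1 + (c i)%:~R ^+ 2)^-1 <= 8 ^+ N :> R.
Proof.
move=> us; pose vs := undup (flatten [seq codom c | c : {ffun 'I_N -> int} <- s]).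
pose w (m : int) : R := (1 + m%:~R ^+ 2)^-1.
have w0 m : 0 <= w m by rewrite invr_ge0 addr_ge0 ?sqr_ge0.
have vsP (c : {ffun 'I_N -> int}) i : c \in s -> c i \in vs.
  move=> cs; rewrite mem_undup; apply/flattenP; exists (codom c); last exact: codom_f.
  by apply/mapP; exists c.
pose phi (f : {ffun 'I_N -> seq_sub vs}) : {ffun 'I_N -> int} := [ffun i => val (f i)].
have phiI : injective phi.
  move=> f g /ffunP fg; apply/ffunP => i; apply: val_inj.
  by have := fg i; rewrite !ffunE.
apply: (@le_trans _ _ (\sum_(c <- map phi (enum {: {ffun 'I_N -> seq_sub vs}})) \prod_i w (c i))).
  have uphi : uniq (map phi (enum {: {ffun 'I_N -> seq_sub vs}})).
    by rewrite map_inj_uniq // enum_uniq.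
  apply: (ler_sum_subset _ _ _ _ _ _ us uphi) => [c|c cs]; first by rewrite /= prodr_ge0 // => i _; exact: w0.
  apply/mapP; exists [ffun i => SeqSub (vsP c i cs)]; first by rewrite mem_enum.
  by apply/ffunP => i; rewrite !ffunE.
rewrite big_map big_enum /=.
under eq_bigr do under eq_bigr do rewrite ffunE.
rewrite -(bigA_distr_bigA (fun i (j : seq_sub vs) => w (val j))) prodr_const card_ord.
apply: lerXn2r; rewrite ?nnegrE //; first by apply: sumr_ge0.
have -> : \sum_(j : seq_sub vs) w (val j) = \sum_(m <- vs) w m.
  rewrite -big_enum -(big_map val xpredT w) /=; apply: perm_big.
  have uv : uniq (map val (enum {: seq_sub vs})).
    by rewrite (map_inj_uniq val_inj) enum_uniq.
  apply: (uniq_perm uv (undup_uniq _)) => m; apply/mapP/idP => [[j _ ->]|mvs]; first exact: (valP j).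
  by exists (SeqSub mvs); rewrite ?mem_enum.
exact/sum_int_inv_sqr/undup_uniq.
Qed.

(** The exponential series dominates each of its single terms. *)
Lemma exprn_expRN_le (x : R) m : 0 <= x -> x ^+ m.+1 * expR (- x) <= m.+1`!%:R.
Proof.
move=> x0; rewrite expRN ler_pdivrMr ?expR_gt0 // mulrC -ler_pdivrMr ?ltr0n ?fact_gt0 //.
by apply: le_trans (expR_ge1Dxn m x0); rewrite lerDr.
Qed.

End IntegerVectors.

(** * Integers of a totally real field *)

(** Induction on the number of nonzero coefficients. Replacing [x] by [y * x] and subtracting
    [s j0 y] times the relation kills the coefficient at [j0]; the shorter relation is trivial, so
    only [c j0] could survive, and [x = 1] excludes that. *)
Lemma dedekind_independence (F K : fieldType) (n : nat)
    (s : 'I_n -> {rmorphism F -> K}) (c : 'I_n -> K) :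
  (forall i j, s i =1 s j -> i = j) ->
  (forall x, \sum_j c j * s j x = 0) -> forall j, c j = 0.
Proof.
move=> s_inj; have [m] := ubnP #|[pred j | c j != 0]|.
elim: m c => // m IH c; rewrite ltnS => le_m c0 j0.
apply/eqP/negPn/negP => cj0.
have ci i : i != j0 -> c i = 0.
  move=> ij; apply/eqP/negPn/negP => ci.
  have [y /eqP sy] : exists y, s i y <> s j0 y.
    by apply/existsNP => h; move: ij; rewrite (s_inj _ _ h) eqxx.
  suff /(_ i)/eqP : forall j, c j * (s j y - s j0 y) = 0.
    by rewrite mulf_eq0 (negPf ci) subr_eq0 (negPf sy).
  apply: IH.
    apply: leq_trans le_m; apply: proper_card; apply/properP; split.
      apply/fintype.subsetP => j; rewrite !inE; apply: contra => /eqP ->.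
      by rewrite mul0r.
    by exists j0; rewrite !inE ?cj0 // subrr mulr0 eqxx.
  move=> x; transitivity (\sum_j c j * s j (y * x) - s j0 y * \sum_j c j * s j x).
    rewrite mulr_sumr -sumrB; apply: eq_bigr => j _; rewrite rmorphM.
    by rewrite mulrBr mulrBl -!mulrA (mulrCA (c j) (s j0 y)).
  by rewrite !c0 mulr0 subr0.
have := c0 1; rewrite (bigD1 j0) //= rmorph1 mulr1 big1 ?addr0; last first.
  by move=> i /ci ->; rewrite mul0r.
by move/eqP; rewrite (negPf cj0).
Qed.

Lemma ring_of_integersM (F : fieldExtType rat) (x y : F) :
  ring_of_integers x -> ring_of_integers y -> ring_of_integers (x * y).
Proof. by rewrite /ring_of_integers /=; apply: mxpoly.integral_mul. Qed.

(** Clear denominators in the minimal polynomial to get [q] over the integers with leading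
    coefficient [a]; then [a x] is a root of the monic polynomial [a^(d-1) q(X/a)]. *)
Lemma integral_multiple (F : fieldExtType rat) (x : F) :
  exists2 a : int, a != 0 & ring_of_integers (a%:~R * x).
Proof.
have /polyOver1P [p0 Dp] := minPolyOver 1%AS x.
have [q [a a0 Dq]] := rat_poly_scale p0.
exists a => //.
have px : \sum_(i < size q) (q`_i)%:~R * x ^+ i = 0.
  have := root_minPoly 1%AS x; rewrite Dp Dq /root map_polyZ /= hornerZ.
  rewrite mulf_eq0 => /orP[|/eqP].
    by rewrite scaler_eq0 oner_eq0 orbF invr_eq0 intr_eq0 (negPf a0).
  rewrite -map_poly_comp /= horner_coef size_map_inj_poly ?rmorph0 //; last first.
    exact: (inj_comp (fmorph_inj (in_alg F)) (@intr_inj rat)).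
  move=> px; rewrite -[RHS]px; apply: eq_bigr => i _; congr (_ * _).
  by rewrite coef_map_id0 ?rmorph0 //; exact: esym (rmorph_int (in_alg F) _).
have lcq : lead_coef q = a.
  have : p0 \is monic by rewrite -(map_monic (in_alg F)) -Dp monic_minPoly.
  rewrite Dq monicE lead_coefZ lead_coef_map_inj //; last exact: intr_inj.
  rewrite mulrC => /eqP /divr1_eq /intr_inj; apply.
have aF : (a%:~R : F) != 0.
  by rewrite -(rmorph_int (in_alg F)) fmorph_eq0 intr_eq0.
have q0 : q != 0 by rewrite -lead_coef_eq0 lcq.
set d := (size q).-1.
have sq : size q = d.+1 by rewrite prednK // size_poly_gt0.
have qd : q`_d = a by rewrite -lcq.
have d0 : (0 < d)%N.
  rewrite lt0n; apply/eqP => d0; move: px; rewrite sq d0 big_ord_recl big_ord0 /=.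
  rewrite addr0 expr0 mulr1; move: qd; rewrite d0 => -> /eqP.
  by rewrite (negPf aF).
(* The leading term stands apart: at [i = d] the truncated exponent [d.-1 - i] would give the
   coefficient [a] instead of 1. *)
pose r : {poly int} := 'X^d + \poly_(i < d) (q`_i * a ^+ (d.-1 - i)).
exists r.
  by rewrite /r monicE lead_coefDl ?lead_coefXn // size_polyXn ltnS size_poly.
rewrite /root /r rmorphD /= map_polyXn hornerD hornerXn.
have -> : (map_poly intr (\poly_(i < d) (q`_i * a ^+ (d.-1 - i)))).[a%:~R * x] =
   \sum_(i < d) (q`_i)%:~R * a%:~R ^+ d.-1 * x ^+ i :> F.
  rewrite (@horner_coef_wide _ d); last first.
    exact: leq_trans (size_poly _ _) (size_poly _ _).
  apply: eq_bigr => i _; rewrite coef_map_id0 // coef_poly ltn_ord.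
  rewrite exprMn mulrA; congr (_ * _); rewrite intrM -mulrA; congr (_ * _).
  rewrite rmorphXn /= -exprD subnK // -ltnS prednK //.
apply/eqP; move: px; rewrite sq big_ord_recr /= qd => px.
have -> : \sum_(i < d) (q`_i)%:~R * a%:~R ^+ d.-1 * x ^+ i =
          a%:~R ^+ d.-1 * \sum_(i < d) (q`_i)%:~R * x ^+ i :> F.
  by rewrite mulr_sumr; apply: eq_bigr => i _; rewrite -mulrA mulrCA.
have /eqP := px; rewrite addr_eq0 => /eqP ->.
by rewrite mulrN mulrA -exprSr prednK // exprMn subrr.
Qed.

(** * Trace form, norms and coordinates of integers *)

Section Lattice.
Variables (R : realType) (F : fieldExtType rat) (n : nat).
Variables (sigma : 'I_n -> {rmorphism F -> R}).
Hypothesis degF : \dim {:F} = n.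
Hypothesis embF : enumerates_real_embeddings sigma.

Lemma embeddings_inj i j : sigma i =1 sigma j -> i = j.
Proof.
move=> h; have [l [_ u]] := embF (sigma i).
by rewrite -(u i) // (u j).
Qed.

Lemma deg_gt0 : (0 < n)%N.
Proof. by rewrite -degF adim_gt0. Qed.

Lemma rmorph_scale_rat j (q : rat) (x : F) : sigma j (q *: x) = ratr q * sigma j x.
Proof.
rewrite -mulr_algl rmorphM /=; congr (_ * _).
exact: (fmorph_eq_rat (sigma j \o in_alg F)).
Qed.

(** A Q-basis scaled into the integers. Its independence is expressed as nonsingularity of the real
    matrix [sigma j (e i)]: a relation on the basis extends Q-linearly to all of [F], against
    Dedekind. *)
Lemma integral_basis : exists2 e : 'I_n -> F,
  forall i, ring_of_integers (e i) &
  forall v : 'I_n -> R, (forall i, \sum_j v j * sigma j (e i) = 0) ->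
    forall j, v j = 0.
Proof.
pose b : 'I_n -> F := fun i => (vbasis {:F})`_i.
have [a a0 ab] : exists2 a : 'I_n -> int, forall i, a i != 0 &
    forall i, ring_of_integers ((a i)%:~R * b i).
  have h i : exists a : int, a != 0 /\ ring_of_integers (a%:~R * b i).
    by have [a ? ?] := integral_multiple F (b i); exists a.
  by have [a ha] := choice h; exists a => i; case: (ha i).
exists (fun i => (a i)%:~R * b i) => // v hv.
apply: (dedekind_independence _ _ _ sigma) => [|x]; first exact: embeddings_inj.
have hb i : \sum_j v j * sigma j (b i) = 0.
  have := hv i; under eq_bigr do rewrite rmorphM rmorph_int mulrCA.
  rewrite -mulr_sumr => /eqP; rewrite mulf_eq0 intr_eq0 (negPf (a0 i)) /=.
  by move/eqP.
have -> : x = \sum_(i < \dim {:F}) coord (vbasis {:F}) i x *: (vbasis {:F})`_i.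
  by apply: coord_vbasis; rewrite memvf.
under eq_bigr do rewrite rmorph_sum mulr_sumr.
rewrite exchange_big big1 //= => i _.
under eq_bigr do rewrite rmorph_scale_rat mulrCA.
by rewrite -mulr_sumr (hb (cast_ord degF i)) mulr0.
Qed.

Variable nu : F.
Hypothesis nu_dual : dual_of_integers sigma nu.
Hypothesis nu_pos : totally_positive sigma nu.

(* The Gram matrix of the form tr(nu * g * x * y) on the lattice spanned by an
   integral basis is an integral matrix of determinant N(g) * const. *)
Lemma norm_lower_bound : exists2 c : R, 0 < c &
  forall g, ring_of_integers g -> g != 0 -> c <= \prod_j `|sigma j g|.
Proof.
have [e eint efree] := integral_basis.
pose A := \matrix_(j, i) sigma j (e i) : 'M[R]_n.
have dA : \det A != 0.
  apply/det0P => -[v v0 vA]; case/negP: v0; apply/eqP/rowP => j; rewrite mxE.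
  apply: (efree (fun j => v 0 j)) => i.
  have /rowP /(_ i) := vA; rewrite !mxE => vAi; rewrite -[RHS]vAi.
  by apply: eq_bigr => l _; rewrite mxE.
pose c := \det A ^+ 2 * \prod_j sigma j nu.
have nu0 : \prod_j sigma j nu > 0 by apply: prodr_gt0 => j _; exact: nu_pos.
have c0 : 0 < c by rewrite mulr_gt0 // exprn_even_gt0.
exists c^-1; first by rewrite invr_gt0.
move=> g gint g0.
pose G := A^T *m diag_mx (\row_j sigma j (nu * g)) *m A.
have GE i l : G i l = trF sigma (nu * (g * (e i * e l))).
  rewrite /G mul_mx_diag !mxE; apply: eq_bigr => j _; rewrite !mxE.
  by rewrite !rmorphM mulrAC mulrC !mulrA.
have dG : \det G = c * \prod_j sigma j g.
  rewrite /G !det_mulmx det_tr det_diag mulrAC -expr2 /c -mulrA; congr (_ * _).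
  by rewrite -big_split; apply: eq_bigr => j _; rewrite mxE rmorphM.
have Gint : \det G \is a Num.int.
  rewrite /determinant rpred_sum // => s _; rewrite rpredM ?rpred_sign //.
  rewrite rpred_prod // => i _; rewrite GE; apply: nu_dual.
  by apply: ring_of_integersM => //; exact: ring_of_integersM.
have G0 : \det G != 0.
  rewrite dG; apply: mulf_neq0; first by rewrite gt_eqF.
  apply/prodf_neq0 => j _.
  by rewrite fmorph_eq0.
have := norm_intr_ge1 Gint G0.
by rewrite dG normrM normr_prod (gtr0_norm c0) -ler_pdivrMl // mulr1.
Qed.

(** If the norm were below 1, the powers of [g], again nonzero integers, would have norms tending to
    0, against the uniform lower bound. *)
Lemma norm_integer_ge1 g : ring_of_integers g -> g != 0 ->
  1 <= \prod_j `|sigma j g|.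
Proof.
move=> gint g0; have [c c0 hc] := norm_lower_bound.
rewrite leNgt; apply/negP => lt1; set p := \prod_j _ in lt1.
have p0 : 0 <= p by apply: prodr_ge0 => j _.
have [m pm] : exists m, p ^+ m < c.
  have h : (GRing.exp p : R^nat) @ \oo --> (0 : R) by apply: cvg_expr; rewrite ger0_norm.
  have [N _ hN] := cvgr_lt 0 h _ c0.
  by exists N; apply: hN => /=.
have : c <= p ^+ m.
  have -> : p ^+ m = \prod_j `|sigma j (g ^+ m)|.
    by rewrite /p -prodrXl; apply: eq_bigr => j _; rewrite rmorphXn normrX.
  apply: hc; last exact: expf_neq0.
  elim: m {pm} => [|m IH]; first exact: mxpoly.integral1.
  by rewrite exprS; apply: ring_of_integersM.
by rewrite leNgt pm.
Qed.

Lemma norm_unit g h : ring_of_integers g -> ring_of_integers h -> g * h = 1 ->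
  \prod_j `|sigma j g| = 1.
Proof.
move=> gint hint gh.
have g0 : g != 0 by apply: contra_eq_neq gh => ->; rewrite mul0r eq_sym oner_eq0.
have h0 : h != 0 by apply: contra_eq_neq gh => ->; rewrite mulr0 eq_sym oner_eq0.
have gge := norm_integer_ge1 g gint g0; have hge := norm_integer_ge1 h hint h0.
apply/eqP; rewrite eq_le gge andbT.
rewrite -[leRHS](_ : (\prod_j `|sigma j g|) * (\prod_j `|sigma j h|) = 1).
  by rewrite ler_peMr //; apply: le_trans gge.
by rewrite -big_split big1 //= => j _; rewrite -normrM -rmorphM gh rmorph1 normr1.
Qed.

Lemma integer_coordinates : exists2 C : R, 1 <= C &
  exists c : F -> {ffun 'I_n -> int},
    (forall x y, ring_of_integers x -> ring_of_integers y -> c x = c y -> x = y) /\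
    forall x (U : R), ring_of_integers x -> (forall j, `|sigma j x| <= U) ->
      forall i, `|(c x i)%:~R| <= C * U.
Proof.
have [e eint efree] := integral_basis.
pose C := 1 + \sum_i \sum_j sigma j nu * `|sigma j (e i)|.
have C0 i j : 0 <= sigma j nu * `|sigma j (e i)|.
  by rewrite mulr_ge0 // ltW // nu_pos.
exists C; first by rewrite lerDl; do 2!apply: sumr_ge0 => ? _.
(* For integral [x] the trace is already an integer, as [nu] is in the inverse different; the floor
   only gives it type [int]. *)
pose c (x : F) := [ffun i => Num.floor (trF sigma (nu * (x * e i)))].
have cE x i : ring_of_integers x -> (c x i)%:~R = trF sigma (nu * (x * e i)).
  by move=> xint; rewrite ffunE floorK //; apply/nu_dual/ring_of_integersM.
exists c; split.
  move=> x y xint yint cxy.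
  have /(_ (Ordinal deg_gt0))/eqP : forall j, sigma j (nu * (x - y)) = 0.
    apply: efree => i.
    transitivity ((c x i)%:~R - (c y i)%:~R : R); last by rewrite cxy subrr.
    rewrite !cE // /trF -sumrB; apply: eq_bigr => j _.
    by rewrite -rmorphM -rmorphB; congr (sigma j _); rewrite -!mulrA mulrBl mulrBr.
  rewrite fmorph_eq0 mulf_eq0 subr_eq0 => /orP[/eqP nu0|/eqP//].
  by have := nu_pos (Ordinal deg_gt0); rewrite nu0 rmorph0 ltxx.
move=> x U xint hU i; rewrite cE //.
have U0 : 0 <= U by apply: le_trans (hU (Ordinal deg_gt0)).
apply: le_trans (ler_norm_sum _ _ _) _.
apply: (@le_trans _ _ (\sum_j (sigma j nu * `|sigma j (e i)|) * U)).
  apply: ler_sum => j _; rewrite !rmorphM !normrM gtr0_norm ?nu_pos //.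
  by rewrite -[leRHS]mulrA ler_pM2l ?nu_pos // mulrC ler_wpM2l.
rewrite -mulr_suml ler_wpM2r // /C [X in _ <= 1 + X](bigD1 i) //= addrCA lerDl addr_ge0 //.
by do 2!apply: sumr_ge0 => ? _.
Qed.

End Lattice.

(** * Cosets of Gamma_inf *)

Section Cosets.
Variable F : fieldExtType rat.

Lemma Gamma_inf_cosetP (M N : 'M[F]_2) : SL2_OF M ->
  Gamma_inf_coset M N <-> [/\ SL2_OF N, N 1 0 = M 1 0 & N 1 1 = M 1 1].
Proof.
move=> [Mint dM].
have ord2 (l : 'I_2) : l = 0 \/ l = 1.
  by case: l => -[|[|//]] ?; [left|right]; apply: val_inj.
split.
  move=> [T GT <-]; have [e1 e2 e3 e4] := mul_Gamma_inf F T M GT.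
  have [_ Tint _ _] := GT; split=> //; split.
    have addI (x y z : F) : ring_of_integers x -> ring_of_integers y ->
        ring_of_integers z -> ring_of_integers (x + y * z).
      move=> xi yi zi; rewrite /ring_of_integers /=.
      by apply: mxpoly.integral_add => //; apply: ring_of_integersM.
    move=> i j.
    by case: (ord2 i) => ->; case: (ord2 j) => ->; rewrite ?e1 ?e2 ?e3 ?e4 //; exact: addI.
  rewrite det_mx2 e1 e2 e3 e4; rewrite det_mx2 in dM; rewrite -dM; ring.
move=> [[Nint dN] e1 e2].
(* The upper right entry of [N M^-1], which is unipotent because the bottom rows agree. *)
pose mu := N 0 1 * M 0 0 - N 0 0 * M 0 1.
have muI : ring_of_integers mu.
  rewrite /ring_of_integers /=.
  by apply: mxpoly.integral_sub; apply: ring_of_integersM.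
pose T : 'M[F]_2 := \matrix_(i, j) (if i == 0 then if j == 0 then 1 else mu
                                    else if j == 0 then 0 else 1).
have GT : Gamma_inf T by split; rewrite !mxE.
exists T => //; have [t1 t2 t3 t4] := mul_Gamma_inf F T M GT.
have T01 : T 0 1 = mu by rewrite mxE.
rewrite det_mx2 in dM; rewrite det_mx2 e1 e2 in dN.
apply/matrixP => i j; case: (ord2 i) => ->; case: (ord2 j) => ->.
(* Multiplying the entry of [N] by [det M] and that of [M] by [det N], both 1, turns the claim into
   a polynomial identity. *)
- rewrite t1 T01 /mu -[in RHS](mulr1 (N 0 0)) -dM -[in LHS](mulr1 (M 0 0)).
  rewrite -{1}dN; ring.
- rewrite t2 T01 /mu -[in RHS](mulr1 (N 0 1)) -dM -[in LHS](mulr1 (M 0 1)).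
  rewrite -{1}dN; ring.
- by rewrite t3 e1.
- by rewrite t4 e2.
Qed.

Lemma Gamma_inf_coset_eq (M N : 'M[F]_2) : SL2_OF M -> SL2_OF N ->
  M 1 0 = N 1 0 -> M 1 1 = N 1 1 -> Gamma_inf_coset M = Gamma_inf_coset N.
Proof.
move=> hM hN e1 e2; apply/seteqP; split => L.
  by move=> /(Gamma_inf_cosetP _ _ hM)[? ? ?]; apply/(Gamma_inf_cosetP _ _ hN); rewrite -e1 -e2.
by move=> /(Gamma_inf_cosetP _ _ hN)[? ? ?]; apply/(Gamma_inf_cosetP _ _ hM); rewrite e1 e2.
Qed.

Lemma Gamma_inf_coset_self (M : 'M[F]_2) : SL2_OF M -> Gamma_inf_coset M M.
Proof. by move=> hM; apply/Gamma_inf_cosetP. Qed.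

Lemma Gamma_inf_quot_rep (I : set F) (C : set 'M[F]_2) : Gamma_inf_quot I C ->
  Gamma0 I (xget 1%:M C) /\ C = Gamma_inf_coset (xget 1%:M C).
Proof.
move=> [M [hM IM] <-].
have /(Gamma_inf_cosetP _ _ hM)[hN e1 e2] :
    Gamma_inf_coset M (xget 1%:M (Gamma_inf_coset M)).
  by apply: xgetPex; exists M; exact: Gamma_inf_coset_self.
by split; [split; rewrite ?e1 | apply: Gamma_inf_coset_eq].
Qed.

(** All matrices of a coset share their bottom row, so the choice of representative is harmless, and
    the row determines the coset. *)
Definition bottom_row (C : set 'M[F]_2) : F * F := (xget 1%:M C 1 0, xget 1%:M C 1 1).

Lemma bottom_row_coset (M : 'M[F]_2) : SL2_OF M ->
  bottom_row (Gamma_inf_coset M) = (M 1 0, M 1 1).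
Proof.
move=> hM; have /(Gamma_inf_cosetP _ _ hM)[_ e1 e2] :
    Gamma_inf_coset M (xget 1%:M (Gamma_inf_coset M)).
  by apply: xgetPex; exists M; exact: Gamma_inf_coset_self.
by rewrite /bottom_row e1 e2.
Qed.

Lemma bottom_row_inj (I : set F) C C' : Gamma_inf_quot I C -> Gamma_inf_quot I C' ->
  bottom_row C = bottom_row C' -> C = C'.
Proof.
move=> [M [hM _] <-] [N [hN _] <-]; rewrite !bottom_row_coset // => -[? ?].
exact: Gamma_inf_coset_eq.
Qed.

End Cosets.

(** * Terms of the Poincare series *)

Section Poincare.
Variables (R : realType) (F : fieldExtType rat) (n : nat).
Variables (sigma : 'I_n -> {rmorphism F -> R}) (nu : F).
Hypothesis degF : \dim {:F} = n.
Hypothesis embF : enumerates_real_embeddings sigma.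
Hypothesis nu_dual : dual_of_integers sigma nu.
Hypothesis nu_pos : totally_positive sigma nu.

Let n_gt0 : (0 < n)%N := deg_gt0 F n degF.

(* With this choice of z the terms of diag(e, e^-1) are exponentials of
   - 2 pi t tr(e^2), which by AM-GM is largest exactly at the units e = 1, -1. *)
Definition base_point (t : R) (j : 'I_n) : R[i] := (0 +i* (t / sigma j nu))%C.

(** The [u_j] of the overview, as a function of the bottom row [p = (g, d)]. *)
Definition den_abs (t : R) (p : F * F) (j : 'I_n) : R :=
  cabs R (cemb sigma j p.1 * base_point t j + cemb sigma j p.2).

Definition term_abs (t : R) (m : nat) (p : F * F) : R :=
  \prod_j ((den_abs t p j)^-1 ^+ m * expR (- (2 * pi * t * (den_abs t p j) ^- 2))).

Lemma den_abs_ge0 t p j : 0 <= den_abs t p j.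
Proof. exact: cabs_ge0. Qed.

Lemma den_abs_sqr t p j :
  den_abs t p j ^+ 2 = (sigma j p.2) ^+ 2 + (sigma j p.1 * (t / sigma j nu)) ^+ 2.
Proof.
rewrite /den_abs cabs_sqr /cemb /base_point; congr (_ ^+ 2 + _ ^+ 2) => /=.
  by rewrite mulr0 mul0r subr0 add0r.
by rewrite mul0r addr0 addr0.
Qed.

Lemma den_abs_ge2 t p j : `|sigma j p.2| <= den_abs t p j.
Proof.
rewrite -(@ler_pXn2r _ 2) ?nnegrE ?den_abs_ge0 // den_abs_sqr real_normK ?num_real //.
by rewrite lerDl sqr_ge0.
Qed.

Lemma den_abs_ge1 t p j : 0 < t -> `|sigma j p.1| * (t / sigma j nu) <= den_abs t p j.
Proof.
move=> t0; have h : 0 < t / sigma j nu by rewrite divr_gt0 // nu_pos.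
rewrite -(@ler_pXn2r _ 2) ?nnegrE ?den_abs_ge0 //; last by rewrite mulr_ge0 // ltW.
rewrite den_abs_sqr !exprMn real_normK ?num_real //.
by rewrite lerDr sqr_ge0.
Qed.

Lemma base_point_upper t : 0 < t -> upper_half_space (base_point t).
Proof. by move=> t0 j; rewrite /= divr_gt0 // nu_pos. Qed.

(** The usual formula [Im (Mz) = Im z / |gz + d|^2]; the factor [1 / nu_j] in the base point cancels
    [nu_j]. *)
Lemma Im_moebius_base t (M : 'M[F]_2) j : 0 < t -> \det M = 1 ->
  sigma j nu * complex.Im (moebius sigma M (base_point t) j) =
  t * den_abs t (M 1 0, M 1 1) j ^- 2.
Proof.
move=> t0 dM; have h := nu_pos j.
have d0 : den_abs t (M 1 0, M 1 1) j ^+ 2 != 0.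
  by rewrite expf_neq0 // gt_eqF // cabs_gt0 den_neq0 //; exact: base_point_upper.
move: d0; rewrite den_abs_sqr /moebius /cemb /base_point /=.
have := congr1 (sigma j) dM; rewrite det_mx2 rmorphB !rmorphM rmorph1.
move: (sigma j (M 0 0)) (sigma j (M 0 1)) (sigma j (M 1 0)) (sigma j (M 1 1)).
move: (sigma j nu) h => v v0 a b c d dt d0; simpc => /=.
move: d0; move: (d ^+ 2 + _) => D d0.
transitivity (t * (a * d - b * c) / D); last by rewrite dt mulr1.
by field; rewrite d0 gt_eqF.
Qed.

Lemma cabs_poincare_term t (m : nat) (M : 'M[F]_2) : 0 < t -> \det M = 1 ->
  cabs R (poincare_term sigma (fun=> m%:Z) nu (base_point t) M) =
  term_abs t m (M 1 0, M 1 1).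
Proof.
move=> t0 dM; rewrite /poincare_term cabsM cabs_expC /term_abs big_split /=.
congr (_ * _).
  rewrite /mu_pow cabs_prod; apply: eq_bigr => j _.
  by rewrite -exprnN cabsV cabsX -exprVn.
rewrite -expR_sum; congr expR.
rewrite sumrN -mulr_sumr; set w := tr_mul _ _ _.
have -> : complex.Re ((2 * pi)%:C%C * 'i%C * w) = - (2 * pi * complex.Im w).
  by case: w => x y; simpc => /=; ring.
congr (- _); rewrite -[RHS]mulrA; congr (_ * _).
have ImD : {morph @complex.Im R : x y / x + y} by move=> [? ?] [? ?].
rewrite /w /tr_mul (big_morph _ ImD (erefl _)) mulr_sumr; apply: eq_bigr => j _.
rewrite -Im_moebius_base // /cemb.
by move: (moebius _ _ _ _) => [x y]; simpc.
Qed.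

(** * Absolute convergence over bottom rows *)

Lemma den_abs_gt0 t p : 1 <= \prod_j den_abs t p j ->
  forall j, 0 < den_abs t p j.
Proof.
move=> h j; rewrite lt_def den_abs_ge0 andbT; apply/eqP => d0.
by move: h; rewrite (bigD1 j) //= d0 mul0r ler10.
Qed.

(** Weight beyond [l] enters only through the product of the [u_j], so convergence can be settled at
    one fixed weight. *)
Lemma term_abs_split t m l p :
  term_abs t (m + l) p = (\prod_j den_abs t p j)^-1 ^+ m * term_abs t l p.
Proof.
rewrite /term_abs -prodfV -prodrXl -big_split; apply: eq_bigr => j _ /=.
by rewrite exprD mulrA.
Qed.

(** A set containing all bottom rows once [t] is large; the bound on the product makes every [u_j]
    positive and the largest at least 1. *)
Definition admissible (t : R) : set (F * F) :=
  [set p | [/\ ring_of_integers p.1, ring_of_integers p.2 &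
              1 <= \prod_j den_abs t p j]].

(** With [x = 2 pi t / u^2 >= u^-2], the left side is at most [x^(m+1) exp(-x)]; this controls the
    pole at [u = 0] uniformly in [t]. *)
Lemma factor_le (t u : R) (m : nat) : 1 <= t -> 0 < u ->
  u^-1 ^+ (2 * m.+1) * expR (- (2 * pi * t * u ^- 2)) <= m.+1`!%:R.
Proof.
move=> t1 u0; set x := 2 * pi * t * u ^- 2.
have u2 : 0 <= u ^- 2 by rewrite invr_ge0 exprn_ge0 // ltW.
have ux : u ^- 2 <= x.
  rewrite /x ler_peMl //; have := pi_ge2 R; nra.
apply: le_trans (exprn_expRN_le _ _ m (le_trans u2 ux)).
rewrite ler_wpM2r ?expR_ge0 // exprM exprVn lerXn2r // nnegrE //.
exact: le_trans ux.
Qed.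

(** [U] is the largest [u_j]. Its own factor supplies the decay [U^(-4n)], and [factor_le] bounds
    each other factor by [(2n)!]. *)
Lemma term_abs_le_max (t : R) p : 1 <= t -> 1 <= \prod_j den_abs t p j ->
  exists2 U : R, 1 <= U &
    (forall j, den_abs t p j <= U) /\
    term_abs t (2 * n.*2) p <= (n.*2)`!%:R ^+ n * U^-1 ^+ (2 * n.*2).
Proof.
move=> t1 h; have d0 := den_abs_gt0 t p h.
pose j0 := Order.arg_max (Ordinal n_gt0) xpredT (den_abs t p).
have dmax j : den_abs t p j <= den_abs t p j0.
  by rewrite /j0; case: arg_maxP => //= i _; apply.
have U1 : 1 <= den_abs t p j0.
  rewrite leNgt; apply/negP => lt1; move: h; apply/negP; rewrite -ltNge.
  rewrite (bigD1 j0) //=; apply: le_lt_trans (lt1).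
  rewrite ler_piMr // ?den_abs_ge0 //.
  apply: prodr_ile1 => j _; rewrite den_abs_ge0 /=.
  exact: le_trans (dmax j) (ltW lt1).
exists (den_abs t p j0) => //; split=> //.
have [m mE] : exists m, n.*2 = m.+1 by exists n.*2.-1; rewrite prednK // double_gt0.
have f1 : 1 <= (n.*2)`!%:R :> R by rewrite ler1n fact_gt0.
have fac j : 0 <= (den_abs t p j)^-1 ^+ (2 * n.*2) * expR (- (2 * pi * t * den_abs t p j ^- 2)).
  by rewrite mulr_ge0 ?expR_ge0 // exprn_ge0 // invr_ge0 den_abs_ge0.
have -> : (n.*2)`!%:R ^+ n = \prod_(j < n) (n.*2)`!%:R :> R.
  by rewrite prodr_const card_ord.
rewrite /term_abs (bigD1 j0) //= [X in _ <= X * _](bigD1 j0) //= [leRHS]mulrAC.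
apply: ler_pM; [exact: fac|by apply: prodr_ge0| |].
  rewrite [leLHS]mulrC; apply: ler_pM; rewrite ?expR_ge0 //.
    by rewrite exprn_ge0 // invr_ge0 den_abs_ge0.
  apply: le_trans f1; rewrite -expR0 ler_expR oppr_le0.
  rewrite mulr_ge0 ?invr_ge0 ?exprn_ge0 ?den_abs_ge0 //.
  by rewrite !mulr_ge0 ?pi_ge0 //; lra.
by apply: ler_prod => j _; rewrite fac /= mE; exact: factor_le.
Qed.

(** A row has [2n] integer coordinates of size [O(U)], so [U^(-4n)] provides one factor of order
    [1 / (1 + c_i^2)] for each coordinate. *)
Lemma admissible_summable t : 1 <= t ->
  exists B, bounded_sums R _ (admissible t) (term_abs t (2 * n.*2)) B.
Proof.
move=> t1.
have [C C1 [c [cI cB]]] := integer_coordinates R F n sigma degF embF nu nu_dual nu_pos.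
(* [V] dominates 1 and every [nu_j], so [|g_j| <= nu_j U / t] and [|d_j| <= U] are both at most
   [V U]. *)
pose V := 1 + \sum_j sigma j nu.
have nuV j : sigma j nu <= V.
  rewrite /V (bigD1 j) //= addrCA lerDl addr_ge0 // sumr_ge0 // => i _.
  exact/ltW/nu_pos.
have V1 : 1 <= V by rewrite lerDl sumr_ge0 // => i _; exact/ltW/nu_pos.
(* Chosen so that [1 + (C V U)^2 <= H U^2], since [C V U >= 1]. *)
pose H := 2 * (C * V) ^+ 2.
pose w (m : int) : R := (1 + m%:~R ^+ 2)^-1.
pose cc (p : F * F) : {ffun 'I_(n + n) -> int} :=
  [ffun i => match fintype.split i with inl a => c p.1 a | inr b => c p.2 b end].
have ccl p i : cc p (lshift n i) = c p.1 i.
  by rewrite ffunE (unsplitK (inl i)).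
have ccr p i : cc p (rshift n i) = c p.2 i.
  by rewrite ffunE (unsplitK (inr i)).
pose K := (n.*2)`!%:R ^+ n * H ^+ n.*2.
have H0 : 0 < H by rewrite mulr_gt0 // exprn_gt0 // mulr_gt0 //; lra.
have K0 : 0 <= K by rewrite mulr_ge0 ?exprn_ge0 // ltW.
have hB : bounded_sums R {ffun 'I_(n + n) -> int} setT
    (fun v => K * \prod_i w (v i)) (K * 8 ^+ (n + n)).
  by apply: bounded_sumsZ => // s us _; exact: sum_intvec_inv_sqr.
exists (K * 8 ^+ (n + n)).
apply: (bounded_sums_map _ _ _ _ _ cc _ _ _ hB) => //.
  move=> [g d] [g' d'] [/= gi di _] [/= gi' di' _] /ffunP e; congr pair.
    apply: cI => //; apply/ffunP => i; by have := e (lshift n i); rewrite !ccl.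
  apply: cI => //; apply/ffunP => i; by have := e (rshift n i); rewrite !ccr.
move=> p [gi di hp].
have [U U1 [dU pU]] := term_abs_le_max t p t1 hp.
apply: le_trans pU _; rewrite /K -mulrA ler_wpM2l ?exprn_ge0 //.
have t0 : 0 < t by apply: lt_le_trans t1.
have U0 : 0 < U by apply: lt_le_trans U1.
have cU i : `|(cc p i)%:~R| <= C * (V * U).
  rewrite -(splitK i); case: (fintype.split i) => a /=; rewrite ?ccl ?ccr.
    apply: cB => // j; have := le_trans (den_abs_ge1 t p j t0) (dU j).
    rewrite mulrA ler_pdivrMr ?nu_pos // => h.
    apply: (@le_trans _ _ (U * sigma j nu)); last by rewrite mulrC ler_wpM2r // ltW.
    by apply: le_trans h; rewrite ler_peMr.
  apply: cB => // j; apply: le_trans (den_abs_ge2 t p j) _.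
  by apply: le_trans (dU j) _; rewrite ler_peMl // ltW.
have wU i : (H * U ^+ 2)^-1 <= w (cc p i).
  have HU : 0 < H * U ^+ 2 by rewrite (mulr_gt0 H0) // exprn_gt0.
  rewrite lef_pV2 ?posrE //; last by rewrite ltr_pwDl // sqr_ge0.
  have : (cc p i)%:~R ^+ 2 <= (C * (V * U)) ^+ 2 :> R.
    rewrite -[leLHS]real_normK ?num_real // lerXn2r // nnegrE //.
    exact: le_trans (cU i).
  have : 1 <= (C * (V * U)) ^+ 2 by rewrite exprn_ege1 // !mulr_ege1.
  by rewrite /H; move: (_%:~R ^+ 2 : R) => y; rewrite !exprMn; lra.
apply: (@le_trans _ _ (H ^+ n.*2 * \prod_(i < n + n) (H * U ^+ 2)^-1)).
  rewrite prodr_const card_ord addnn -exprMn.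
  have -> : H * (H * U ^+ 2)^-1 = U^-1 ^+ 2.
    by rewrite [in LHS]invfM mulrA mulfV ?(gt_eqF H0) // mul1r exprVn.
  by rewrite exprM.
apply: ler_wpM2l; first by rewrite exprn_ge0 // ltW.
apply: ler_prod => i _; rewrite wU andbT invr_ge0 (mulr_ge0 (ltW H0)) //.
by rewrite exprn_ge0 // ltW.
Qed.

(** Multiply the bounds [u_j >= |g_j| t / nu_j] and use [|N(g)| >= 1] and [t^n >= t]. *)
Lemma prod_den_abs_ge t g d : 1 <= t -> ring_of_integers g -> g != 0 ->
  t / \prod_j sigma j nu <= \prod_j den_abs t (g, d) j.
Proof.
move=> t1 gi g0; have t0 : 0 < t by apply: lt_le_trans t1.
have N0 : 0 < \prod_j sigma j nu by apply: prodr_gt0 => j _; exact: nu_pos.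
apply: (@le_trans _ _ (\prod_j (`|sigma j g| * (t / sigma j nu)))); last first.
  apply: ler_prod => j _; rewrite (den_abs_ge1 t (g, d) j t0) andbT.
  by rewrite mulr_ge0 // divr_ge0 // ltW // nu_pos.
rewrite big_split /= big_split /= prodr_const card_ord prodfV.
have N1 := norm_integer_ge1 R F n sigma degF embF nu nu_dual nu_pos g gi g0.
apply: (@le_trans _ _ (t ^+ n / \prod_j sigma j nu)).
  by rewrite ler_pM2r ?invr_gt0 // ler_eXnr.
by rewrite ler_peMl // divr_ge0 ?exprn_ge0 // ltW.
Qed.

(** * The rows [(0, d)] with [d] a unit *)

Definition integer_units : set F :=
  [set d | ring_of_integers d /\ exists2 a, ring_of_integers a & a * d = 1].

Definition inv_sqr_trace (d : F) : R := \sum_j (sigma j d) ^- 2.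

Lemma den_abs_unit t d j : den_abs t (0, d) j = `|sigma j d|.
Proof.
apply/eqP; rewrite -(@eqrXn2 _ 2) //; last exact: den_abs_ge0.
by rewrite [den_abs _ _ _ ^+ 2]den_abs_sqr /= rmorph0 mul0r expr0n addr0 real_normK ?num_real.
Qed.

Lemma prod_den_abs_unit t d : integer_units d -> \prod_j den_abs t (0, d) j = 1.
Proof.
move=> [di [a ai ad]]; under eq_bigr do rewrite den_abs_unit.
by apply: (norm_unit R F n sigma degF embF nu nu_dual nu_pos d a) => //; rewrite mulrC.
Qed.

(** A unit has norm of absolute value 1, so the weight [m] drops out. *)
Lemma term_abs_unit t m d : integer_units d ->
  term_abs t m (0, d) = expR (- (2 * pi * t * inv_sqr_trace d)).
Proof.
move=> du; rewrite /term_abs big_split /=.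
rewrite prodrXl prodfV prod_den_abs_unit // invr1 expr1n mul1r.
rewrite -expR_sum sumrN mulr_sumr; congr (expR (- _)); apply: eq_bigr => j _.
by rewrite den_abs_unit real_normK ?num_real.
Qed.

(** AM-GM for the numbers [d_j^-2], whose product is 1. Equality would make them all equal, hence 1,
    so [d^2 = 1]. *)
Lemma inv_sqr_trace_gt d : integer_units d -> d != 1 -> d != -1 ->
  n%:R < inv_sqr_trace d.
Proof.
move=> du d1 d2; have [di [a ai ad]] := du.
have d0 : d != 0 by apply: contra_eq_neq ad => ->; rewrite mulr0 eq_sym oner_eq0.
have sd0 j : 0 < (sigma j d) ^- 2.
  by rewrite invr_gt0 exprn_even_gt0 // fmorph_eq0.
have nR : 0 < n%:R :> R by rewrite ltr0n.
have P1 : \prod_j (sigma j d) ^- 2 = 1.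
  rewrite prodfV; apply/eqP; rewrite invr_eq1; apply/eqP.
  transitivity ((\prod_j den_abs 1 (0, d) j) ^+ 2); last first.
    by rewrite prod_den_abs_unit // expr1n.
  rewrite -prodrXl; apply: eq_bigr => j _.
  by rewrite den_abs_unit real_normK ?num_real.
have := @leif_AGM R 'I_n xpredT (fun j => (sigma j d) ^- 2) (fun j _ => ltW (sd0 j)).
rewrite /= P1 card_ord -/(inv_sqr_trace d) => -[le1 eq1].
have S0 : 0 <= inv_sqr_trace d / n%:R by rewrite divr_ge0 // sumr_ge0 // => j _; exact: ltW.
have : 1 <= inv_sqr_trace d / n%:R.
  by move: le1; rewrite -[X in X <= _](expr1n _ n) ler_pXn2r ?nnegrE //.
rewrite ler_pdivlMr // mul1r le_eqVlt => /orP[/eqP e|//].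
exfalso; move: eq1; rewrite -e divff ?(gt_eqF nR) // expr1n eqxx => /esym/forallP h.
have c1 j : (sigma j d) ^- 2 = 1.
  have hj i : (sigma i d) ^- 2 = (sigma j d) ^- 2.
    by have /forallP/(_ j)/eqP := h i.
  move: e; rewrite /inv_sqr_trace; under eq_bigr do rewrite hj.
  rewrite sumr_const card_ord => e.
  by apply: (mulfI (lt0r_neq0 nR)); rewrite mulr1 mulr_natl.
have /eqP : d ^+ 2 = 1.
  apply: (fmorph_inj (sigma (Ordinal n_gt0))); rewrite rmorphXn rmorph1.
  by rewrite -[LHS]invrK c1 invr1.
by rewrite sqrf_eq1 (negPf d1) (negPf d2).
Qed.

Definition nontrivial_units : set F := [set d | [/\ integer_units d, d != 1 & d != -1]].

(** With [y d = 2 pi (tr(d^-2) - n) >= g > 0], the term is [exp(-2 pi t n) exp(-t y)], and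
    [exp(-t y) <= exp(-(t-1) g) exp(-y)], where the [exp(-y)] have bounded sums. *)
Lemma nontrivial_units_small : exists t0 : R, forall t, t0 <= t ->
  bounded_sums R F nontrivial_units
    (fun d => expR (- (2 * pi * t * inv_sqr_trace d))) (expR (- (2 * pi * t * n%:R)) / 2).
Proof.
have [B hB] := admissible_summable 1 (lexx 1).
pose y d := 2 * pi * (inv_sqr_trace d - n%:R).
have B1 : bounded_sums R F nontrivial_units
    (fun d => expR (2 * pi * n%:R) * expR (- (2 * pi * 1 * inv_sqr_trace d)))
    (expR (2 * pi * n%:R) * B).
  apply: bounded_sumsZ; first exact: expR_ge0.
  apply: (bounded_sums_map _ _ _ _ _ (fun d => (0, d)) _ _ _ hB).
  - move=> d [du _ _]; split => /=; [exact: mxpoly.integral0|by case: du|].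
    by rewrite prod_den_abs_unit.
  - by move=> d d' _ _ [].
  - by move=> d [du _ _]; rewrite term_abs_unit.
have B2 : bounded_sums R F nontrivial_units (fun d => expR (- y d)) (expR (2 * pi * n%:R) * B).
  move=> s us sD; apply: le_trans (B1 s us sD); rewrite le_eqVlt; apply/orP; left.
  by apply/eqP; apply: eq_bigr => d _; rewrite -expRD /y; congr expR; ring.
have [g g0 hg] : exists2 g, 0 < g & forall d, nontrivial_units d -> g <= y d.
  apply: bounded_sums_gap B2 => d [du d1 d2].
  have := inv_sqr_trace_gt d du d1 d2; rewrite -subr_gt0 => h.
  by rewrite /y mulr_gt0 // mulr_gt0 // pi_gt0.
move: (expR _ * B) B1 B2 => B' B1 B2.
have B'0 : 0 <= B' by have := B1 [::] isT; rewrite big_nil; apply.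
(* Then [exp((t-1) g) >= 1 + (t-1) g >= 1 + 2 B'], which brings the bound [B'] down to at most
   1/2. *)
exists (1 + 2 * B' / g) => t ht.
have t1 : 0 <= t - 1.
  by rewrite subr_ge0; apply: le_trans ht; rewrite lerDl divr_ge0 ?mulr_ge0 // ltW.
have hsmall : expR (- ((t - 1) * g)) * B' <= 1 / 2.
  rewrite expRN mulrC ler_pdivrMr ?expR_gt0 //.
  have : 2 * B' <= (t - 1) * g by rewrite -ler_pdivrMr //; lra.
  have := expR_ge1Dx ((t - 1) * g); lra.
have Bt := bounded_sumsZ R F nontrivial_units _ _ _ (expR_ge0 (- (2 * pi * t * n%:R)))
  (bounded_sumsZ R F nontrivial_units _ _ _ (expR_ge0 (- ((t - 1) * g))) B2).
have hE : expR (- (2 * pi * t * n%:R)) * (expR (- ((t - 1) * g)) * B') <=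
          expR (- (2 * pi * t * n%:R)) / 2.
  by rewrite ler_wpM2l ?expR_ge0 // -[leRHS]mul1r.
move=> s us sD; apply: le_trans (le_trans (Bt s us sD) hE).
rewrite big_seq [leRHS]big_seq; apply: ler_sum => d ds; rewrite -!expRD ler_expR.
have -> : - (2 * pi * t * inv_sqr_trace d) = - (2 * pi * t * n%:R) - t * y d.
  by rewrite /y; ring.
have := ler_wpM2l t1 (hg d (sD d ds)); lra.
Qed.

End Poincare.

(** * Terms of the series grouped by coset *)

Lemma sign_Gamma0 (F : fieldExtType rat) (I : set F) (b : bool) :
  integral_ideal I -> Gamma0 I (((-1) ^+ b)%:M : 'M[F]_2).
Proof.
move=> [_ I0 _ _]; split; last by rewrite mxE.
split; last by rewrite det_scalar sqrr_sign.
move=> i j; rewrite mxE; case: (i == j) => /=; last exact: mxpoly.integral0.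
case: b; rewrite ?expr0 ?expr1 ?mulr1n; last exact: mxpoly.integral1.
rewrite /ring_of_integers /=; apply: mxpoly.integral_opp; exact: mxpoly.integral1.
Qed.

Section Terms.
Variables (R : realType) (F : fieldExtType rat) (n : nat).
Variables (sigma : 'I_n -> {rmorphism F -> R}) (nu : F) (I : set F).
Hypothesis degF : \dim {:F} = n.
Hypothesis embF : enumerates_real_embeddings sigma.
Hypothesis nu_dual : dual_of_integers sigma nu.
Hypothesis nu_pos : totally_positive sigma nu.
Hypothesis idealI : integral_ideal I.

(** Both signs fix [z], where [tr(nu z) = i t n]; the automorphy factor is a sign to the power
    [n m], hence 1. *)
Lemma poincare_term_sign t (m : nat) (b : bool) : ~~ odd (n * m) ->
  poincare_term sigma (fun=> m%:Z) nu (base_point R F n sigma nu t) ((-1) ^+ b)%:M =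
  (expR (- (2 * pi * t * n%:R)))%:C%C.
Proof.
move=> ev; rewrite /poincare_term.
have -> : mu_pow sigma ((-1) ^+ b)%:M (base_point R F n sigma nu t) (fun=> - m%:Z) = 1.
  rewrite /mu_pow; transitivity (\prod_(j < n) ((-1) ^+ (b * m) : R[i])^-1).
    apply: eq_bigr => j _; rewrite !mxE /cemb /= mulr0n mulr1n !rmorph0 mul0r add0r.
    by rewrite !rmorph_sign -exprnN -exprM.
  rewrite prodr_const card_ord invr_sign -exprM -signr_odd.
  by case: b => /=; rewrite ?mul1n ?mul0n // mulnC (negPf ev).
rewrite mul1r; set w := tr_mul _ _ _.
have -> : w = (0 +i* (t * n%:R))%C.
  rewrite /w /tr_mul.
  transitivity (\sum_(j < n) (0 +i* t)%C : R[i]).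
    apply: eq_bigr => j _; rewrite /moebius !mxE /cemb /= !mulr0n !mulr1n !rmorph0.
    rewrite mul0r add0r addr0 !rmorph_sign mulrAC mulfV ?signr_eq0 // mul1r.
    rewrite /base_point; simpc; rewrite mulrC mulfVK //.
    by rewrite (gt_eqF (nu_pos j)).
  rewrite sumr_const card_ord; elim: n => [|l IH]; first by rewrite mulr0.
  by rewrite mulrS IH; simpc; rewrite -natr1 mulrDr mulr1 addrC.
rewrite /expC; simpc => /=.
by rewrite cos0 sin0 !mulr1 mulr0 -!mulrA.
Qed.

Lemma cabs_quotient_term t m C : 0 < t -> Gamma_inf_quot I C ->
  cabs R (poincare_term sigma (fun=> m%:Z) nu (base_point R F n sigma nu t) (xget 1%:M C)) =
  term_abs R F n sigma nu t m (bottom_row F C).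
Proof.
move=> t0 /Gamma_inf_quot_rep[[[_ dM] _] _].
exact: cabs_poincare_term.
Qed.

Lemma bottom_row_integral C : Gamma_inf_quot I C ->
  ring_of_integers (bottom_row F C).1 /\ ring_of_integers (bottom_row F C).2.
Proof. by move=> /Gamma_inf_quot_rep[[[h _] _] _]; split; exact: h. Qed.

Lemma bottom_row_unit C : Gamma_inf_quot I C -> (bottom_row F C).1 = 0 ->
  integer_units F (bottom_row F C).2.
Proof.
move=> hC g0; split; first by case: (bottom_row_integral C hC).
have [[[h dM] _] _] := Gamma_inf_quot_rep _ _ _ hC.
exists (xget 1%:M C 0 0); first exact: h.
by move: dM g0; rewrite det_mx2 /bottom_row /= => + g0; rewrite g0 mulr0 subr0.
Qed.

Lemma bottom_row_admissible t C : 1 <= t -> \prod_j sigma j nu <= t ->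
  Gamma_inf_quot I C -> admissible R F n sigma nu t (bottom_row F C).
Proof.
move=> t1 tN hC; have [gi di] := bottom_row_integral C hC; split => //.
have N0 : 0 < \prod_j sigma j nu by apply: prodr_gt0 => j _; exact: nu_pos.
have [g0|g0] := eqVneq (bottom_row F C).1 0.
  by rewrite (surjective_pairing (bottom_row F C)) g0 prod_den_abs_unit //; apply: bottom_row_unit.
rewrite (surjective_pairing (bottom_row F C)).
apply: le_trans (prod_den_abs_ge _ _ _ _ _ degF embF nu_dual nu_pos _ _ _ t1 gi g0).
by rewrite ler_pdivlMr // mul1r.
Qed.

(** With [g = 0] the coset is determined by the unit [d], and [d = 1], [d = -1] give exactly the two
    excluded cosets. *)
Lemma quotient_units_small (c t : R) (m : nat) :
  bounded_sums R F (nontrivial_units F)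
    (fun d => expR (- (2 * pi * t * inv_sqr_trace R F n sigma d))) c ->
  bounded_sums R _
    [set C | [/\ Gamma_inf_quot I C, (bottom_row F C).1 = 0,
              C != Gamma_inf_coset 1%:M & C != Gamma_inf_coset (-1)%:M]]
    (fun C => term_abs R F n sigma nu t m (bottom_row F C)) c.
Proof.
move=> hc; apply: (bounded_sums_map _ _ _ _ _ (fun C => (bottom_row F C).2) _ _ _ hc).
- move=> C [hC g0 n1 n2]; split; first exact: bottom_row_unit.
    apply: contra_neq n1 => d1; apply: (bottom_row_inj _ I) => //.
      by exists 1%:M => //; exact: (sign_Gamma0 _ _ false).
    rewrite bottom_row_coset; last by case: (sign_Gamma0 _ _ false idealI).
    by rewrite !mxE (surjective_pairing (bottom_row F C)) g0 d1.
  apply: contra_neq n2 => d1; apply: (bottom_row_inj _ I) => //.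
    by exists (-1)%:M => //; exact: (sign_Gamma0 _ _ true).
  rewrite bottom_row_coset; last by case: (sign_Gamma0 _ _ true idealI).
  by rewrite !mxE (surjective_pairing (bottom_row F C)) g0 d1.
- move=> C C' [hC g0 _ _] [hC' g0' _ _] e; apply: (bottom_row_inj _ I) => //.
  by rewrite (surjective_pairing (bottom_row F C)) g0 e -g0' -surjective_pairing.
- move=> C [hC g0 _ _]; have du := bottom_row_unit C hC g0.
  by rewrite [X in term_abs _ _ _ _ _ _ _ X]surjective_pairing g0 term_abs_unit.
Qed.

(** Since [t >= 2 N(nu)], the product of the [u_j] is at least 2, so [l] units of weight beyond [4n]
    gain a factor [2^-l]. *)
Lemma quotient_nonunits_small (B t : R) (l : nat) : 1 <= t ->
  2 * \prod_j sigma j nu <= t ->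
  bounded_sums R _ (admissible R F n sigma nu t) (term_abs R F n sigma nu t (2 * n.*2)) B ->
  bounded_sums R _ [set C | Gamma_inf_quot I C /\ (bottom_row F C).1 != 0]
    (fun C => term_abs R F n sigma nu t (l + 2 * n.*2) (bottom_row F C)) (2^-1 ^+ l * B).
Proof.
move=> t1 t2 hB; have N0 : 0 < \prod_j sigma j nu by apply: prodr_gt0 => j _; exact: nu_pos.
have tN : \prod_j sigma j nu <= t by lra.
have h2 : 0 <= (2^-1 : R) ^+ l by rewrite exprn_ge0 // invr_ge0.
apply: (bounded_sums_map _ _ _ _ _ (bottom_row F) _ _ _ (bounded_sumsZ _ _ _ _ _ _ h2 hB)).
- by move=> C [hC _]; exact: bottom_row_admissible.
- by move=> C C' [hC _] [hC' _]; exact: (bottom_row_inj _ I).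
- move=> C [hC g0]; have [gi di h1] := bottom_row_admissible t C t1 tN hC.
  rewrite term_abs_split // ler_wpM2r //.
    apply: prodr_ge0 => j _; rewrite mulr_ge0 ?expR_ge0 // exprn_ge0 // invr_ge0.
    exact: den_abs_ge0.
  have P2 : 2 <= \prod_j den_abs R F n sigma nu t (bottom_row F C) j.
    rewrite [bottom_row F C]surjective_pairing.
    apply: le_trans (prod_den_abs_ge _ _ _ _ _ degF embF nu_dual nu_pos _ _ _ t1 gi g0).
    by rewrite ler_pdivlMr.
  rewrite lerXn2r ?nnegrE ?invr_ge0 //; first exact: le_trans P2.
  by rewrite lef_pV2 ?posrE //; apply: lt_le_trans P2.
Qed.

End Terms.

(** * Choice of [t] and of the weight bound, and the final estimate *)

Theorem theorem4p1 (R : realType) (F : fieldExtType rat) (n : nat)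
    (sigma : 'I_n -> {rmorphism F -> R}) (nu : F) (I : set F)
    (degF : \dim {:F} = n) (realF : totally_real F R)
    (embF : enumerates_real_embeddings sigma)
    (nu_dual : dual_of_integers sigma nu) (nu_pos : totally_positive sigma nu)
    (idealI : integral_ideal I) (I_neq0 : nonzero_ideal I) :
  exists2 k0 : R, 0 < k0 &
    forall k : int, k0 < k%:~R -> 2 < k -> (2 %| n%:Z * k)%Z ->
      ~ (forall z, upper_half_space z ->
           hilbert_poincare sigma (fun=> k) nu I z = 0).
Proof.
have [t0 ht0] := nontrivial_units_small R F n sigma nu degF embF nu_dual nu_pos.
have N0 : 0 < \prod_j sigma j nu by apply: prodr_gt0 => j _; exact: nu_pos.
(* The three summands give convergence ([t >= 1]), smallness of the unit terms ([t >= t0]) and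
   [u]-products at least 2 when [g] is nonzero. *)
pose t := 1 + `|t0| + 2 * \prod_j sigma j nu.
have t1 : 1 <= t by rewrite /t; have := normr_ge0 t0; lra.
have t2 : 2 * \prod_j sigma j nu <= t by rewrite /t; have := normr_ge0 t0; lra.
have tN : \prod_j sigma j nu <= t by lra.
have tgt0 : 0 < t by lra.
have /ht0 hunits : t0 <= t by rewrite /t; have := ler_norm t0; lra.
have [B hB] := admissible_summable R F n sigma nu degF embF nu_dual nu_pos t t1.
set c := expR _ in hunits; have c0 : 0 < c by exact: expR_gt0.
(* For [l >= K] one has [2^l > 2 B / c], hence [2^-l B < c / 2]; the weight bound adds the [4n]
   spent on convergence. *)
pose K := Num.bound (2 * B / c).
exists (K + 2 * n.*2).+1%:R; first by rewrite ltr0n.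
move=> [m|m] hk _ ev hz; last first.
  by move: hk; rewrite NegzE mulrNz ltNge ltW // (@lt_le_trans _ _ 0) ?oppr_lt0 ?ltr0n.
(* Evenness of [n k] gives the cosets of 1 and -1 equal terms; for [n k] odd the series vanishes by
   [hilbert_poincare_odd]. *)
have {}ev : ~~ odd (n * m) by move: ev; rewrite dvdzE abszM /= dvdn2.
have [l mE Kl] : exists2 l, m = (l + 2 * n.*2)%N & (K <= l)%N.
  have hm : (K + 2 * n.*2 < m)%N by rewrite -(ltr_nat R) (lt_trans _ hk) // ltr_nat.
  exists (m - 2 * n.*2)%N; first by rewrite subnK // ltnW // (leq_ltn_trans (leq_addl _ _) hm).
  by rewrite leq_subRL ?(ltnW (leq_ltn_trans (leq_addl _ _) hm)) // addnC ltnW.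
have zH := base_point_upper R F n sigma nu nu_pos t tgt0.
pose D := Gamma_inf_quot I.
pose f (C : set 'M[F]_2) :=
  poincare_term sigma (fun=> m%:Z) nu (base_point R F n sigma nu t) (xget 1%:M C).
have sum0 : csum D f = 0 by exact: hz _ zH.
have fE C : D C -> cabs R (f C) = term_abs R F n sigma nu t m (bottom_row F C).
  exact: cabs_quotient_term.
have hall : bounded_sums R _ D (fun C => cabs R (f C)) B.
  apply: (bounded_sums_map _ _ _ _ _ (bottom_row F) _ _ _ hB).
  - by move=> C hC; exact: (bottom_row_admissible _ _ _ _ _ I).
  - by move=> C C'; exact: (bottom_row_inj _ I).
  - move=> C hC; rewrite fE // mE.
    have [_ _ h1] : admissible R F n sigma nu t (bottom_row F C).
      exact: (bottom_row_admissible _ _ _ _ _ I).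
    rewrite term_abs_split // ler_piMl //.
      apply: prodr_ge0 => j _; rewrite mulr_ge0 ?expR_ge0 // exprn_ge0 // invr_ge0.
      exact: den_abs_ge0.
    by rewrite exprn_ile1 ?invr_ge0 ?invf_le1 ?(le_trans _ h1) ?(lt_le_trans _ h1).
(* [csum] is also 0 on families that are not summable, so its vanishing becomes a genuine sum only
   through the absolute convergence [hall]. *)
have : has_sum D f 0.
  rewrite -sum0; apply: xgetPex; exact: (has_sum_exists _ _ _ _ _ hall).
pose C1 : set 'M[F]_2 := Gamma_inf_coset 1%:M.
pose C2 : set 'M[F]_2 := Gamma_inf_coset (-1)%:M.
have G1 : Gamma0 I (1%:M : 'M[F]_2) by exact: (sign_Gamma0 _ _ false).
have G2 : Gamma0 I ((-1)%:M : 'M[F]_2) by exact: (sign_Gamma0 _ _ true).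
apply: (has_sum_neq0 _ _ _ _ c C1 C2) => //.
- by exists 1%:M.
- by exists (-1)%:M.
- apply/eqP => /(congr1 (bottom_row F)).
  rewrite !bottom_row_coset; [|by case: G2|by case: G1].
  rewrite !mxE /= => -[/(congr1 (sigma (Ordinal (deg_gt0 F n degF))))].
  by rewrite rmorph1 rmorphN rmorph1 => h; have : (1 : R) > 0 := ltr01; lra.
- rewrite /f (poincare_term_rep _ _ _ _ _ I nu_dual _ zH _ _ 1%:M) //.
  exact: (poincare_term_sign _ _ _ _ _ nu_pos t m false).
- rewrite /f (poincare_term_rep _ _ _ _ _ I nu_dual _ zH _ _ (-1)%:M) //.
  exact: (poincare_term_sign _ _ _ _ _ nu_pos t m true).
move=> s us sD.
rewrite (bigID (fun C => (bottom_row F C).1 == 0)) /=.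
rewrite -[X in X + _]big_filter -[X in _ + X]big_filter.
(* Half of [c] is allotted to the remaining unit rows, half to the rows with [g] nonzero. *)
rewrite [leRHS](splitr c); apply: lerD.
  apply: le_trans (quotient_units_small _ _ _ _ _ I degF embF nu_dual nu_pos idealI _ _ m hunits _ _ _).
  - rewrite big_seq [leRHS]big_seq; apply: ler_sum => C.
    by rewrite mem_filter => /andP[_ /sD[hC _ _]]; rewrite fE.
  - by rewrite filter_uniq.
  - by move=> C; rewrite mem_filter => /andP[/eqP g0 /sD[hC ? ?]].
apply: (@le_trans _ _ (2^-1 ^+ l * B)).
  apply: le_trans (quotient_nonunits_small _ _ _ _ _ I degF embF nu_dual nu_pos _ _ l t1 t2 hB _ _ _).
  - rewrite big_seq [leRHS]big_seq; apply: ler_sum => C.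
    by rewrite mem_filter => /andP[_ /sD[hC _ _]]; rewrite fE // mE.
  - by rewrite filter_uniq.
  - by move=> C; rewrite mem_filter => /andP[g0 /sD[hC _ _]].
have := upper_nthrootP Kl; rewrite ltr_pdivrMr // => h.
rewrite exprVn mulrC ler_pdivrMr ?exprn_gt0 //; lra.
Qed.
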